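(* The zero locus in $OG(2,7)$ of a general global section of the spinor bundle $\mathcal{S}$ is isomorphic to $G_2/P_2$.
   Context: Over $\mathbb{C}$. $OG(2,7)$ is the orthogonal Grassmannian of isotropic $2$-dimensional subspaces $U$ of $V=\mathbb{C}^7$ with a non-degenerate quadratic form. $\Delta$ is the $8$-dimensional spin representation of $Spin_7$, with Clifford action $V\otimes\Delta\to\Delta$. The spinor bundle $\mathcal{S}$ is the homogeneous bundle on $OG(2,7)$ whose fiber at $[U]$ is the cokernel of $U\otimes\Delta\to\Delta$; it has rank $2$ and $H^0(\mathcal{S})=\Delta$. $P_2\subset G_2$ is the maximal parabolic subgroup associated to the long simple root, so that $G_2/P_2$ is the adjoint variety of $G_2$, i.e. the closed orbit in $\mathbb{P}(\mathfrak{g}_2)$ (of dimension $5$). *)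

(* Defs.v *)
(* MathComp world, with multinomials for polynomials and R[i] for the complex
   numbers. *)
From mathcomp Require Import all_boot all_order all_algebra.
From mathcomp Require Import reals complex mpoly.

Set Implicit Arguments.
Unset Strict Implicit.
Unset Printing Implicit Defensive.

Import GRing.Theory.
Local Open Scope ring_scope.

(* A point of the projective space P(W) is a line L : {vspace W} with
   \dim L = 1, and a subset of P(W) is a predicate on such lines. *)
Section ProjectiveVarieties.
Context {K : fieldType}.

(* The coordinates are those of a fixed basis of W; homogeneity, vanishing and
   the notions below do not depend on that basis. *)
Definition poly_on (W : vectType K) := {mpoly K[\dim {:W}]}.

Definition poly_eval (W : vectType K) (p : poly_on W) (w : W) : K :=
  p.@[fun i => coord (vbasis {:W}) i w].

Definition zariski_closed (W : vectType K) (X : {vspace W} -> Prop) : Prop :=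
  exists2 S : poly_on W -> Prop,
    forall p, S p -> exists k : nat, p \is k.-homog
  & forall L : {vspace W}, X L <->
      \dim L = 1%N /\
      forall p, S p -> forall w, w \in L -> poly_eval p w = 0.

Definition poly_map_eval (W W' : vectType K)
    (P : 'I_(\dim {:W'}) -> poly_on W) (w : W) : W' :=
  \sum_i poly_eval (P i) w *: (vbasis {:W'})`_i.

(* Locally around each point of X, f is given by homogeneous polynomials of a
   common degree without common zero. *)
Definition regular_map (W W' : vectType K)
    (X : {vspace W} -> Prop) (Y : {vspace W'} -> Prop)
    (f : {vspace W} -> {vspace W'}) : Prop :=
  (forall L, X L -> Y (f L)) /\
  forall w, X <[w]>%VS ->
    exists k : nat, exists P : 'I_(\dim {:W'}) -> poly_on W,
      [/\ forall i, P i \is k.-homog,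
          poly_map_eval P w != 0
        & forall x, X <[x]>%VS -> poly_map_eval P x != 0 ->
            f <[x]>%VS = <[poly_map_eval P x]>%VS].

Definition isomorphic_varieties (W W' : vectType K)
    (X : {vspace W} -> Prop) (Y : {vspace W'} -> Prop) : Prop :=
  exists (f : {vspace W} -> {vspace W'}) (g : {vspace W'} -> {vspace W}),
    [/\ regular_map X Y f, regular_map Y X g,
        forall L, X L -> g (f L) = L
      & forall M, Y M -> f (g M) = M].

End ProjectiveVarieties.

Section SpinorBundle.
Context {K : fieldType}.

(* Polar form of the quadratic form v |-> polar B v v, B symmetric. *)
Definition polar (B : 'M[K]_7) (u v : 'cV[K]_7) : K := (u^T *m B *m v) 0 0.

Definition nondegenerate_form (B : 'M[K]_7) : Prop :=
  B^T = B /\ B \in unitmx.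

(* A structure of module over the Clifford algebra of (K^7, B) on K^8.  Over an
   algebraically closed field of characteristic not 2, this algebra is a product
   of two algebras of 8 x 8 matrices, so there are exactly two such modules up
   to isomorphism.  They differ by v |-> - v, hence have the same restriction to
   Spin_7, the spin representation, and the same subspaces U.K^8 below. *)
Definition clifford_action (B : 'M[K]_7)
    (gam : {linear 'cV[K]_7 -> 'M[K]_8}) : Prop :=
  forall v, gam v *m gam v = (polar B v v)%:M.

Definition OG27 (B : 'M[K]_7) (U : {vspace 'cV[K]_7}) : Prop :=
  \dim U = 2%N /\ forall u, u \in U -> polar B u u = 0.

(* The alternating matrices form the exterior square of K^7. *)
Definition wedge (u v : 'cV[K]_7) : 'M[K]_7 := u *m v^T - v *m u^T.

Definition pluecker (U : {vspace 'cV[K]_7}) : {vspace 'M[K]_7} :=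
  <[wedge (vbasis U)`_0 (vbasis U)`_1]>%VS.

(* The image of U (x) Delta -> Delta.  The fiber of the spinor bundle at U is
   Delta / clifford_image gam U, and the global section given by
   d \in Delta = H^0(S) takes at U the class of d as value. *)
Definition clifford_image (gam : {linear 'cV[K]_7 -> 'M[K]_8})
    (U : {vspace 'cV[K]_7}) : {vspace 'cV[K]_8} :=
  <<[seq gam u *m psi | u <- vbasis U, psi <- vbasis {:'cV[K]_8}]>>%VS.

Definition section_vanishes (gam : {linear 'cV[K]_7 -> 'M[K]_8})
    (d : 'cV[K]_8) (U : {vspace 'cV[K]_7}) : Prop :=
  d \in clifford_image gam U.

Definition zero_locus (B : 'M[K]_7) (gam : {linear 'cV[K]_7 -> 'M[K]_8})
    (d : 'cV[K]_8) (L : {vspace 'M[K]_7}) : Prop :=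
  exists U, [/\ OG27 B U, section_vanishes gam d U & L = pluecker U].

(* At each zero U = <u, v> of the section, its derivative
   T_U OG(2,7) -> Delta / clifford_image gam U is onto, so that the scheme of
   zeros is smooth of codimension 2 and carries no more structure than its set
   of points.  A tangent vector at U is given by (u', v') such that
   <u + e u', v + e v'> is isotropic modulo e^2; if d = u.a + v.b then
   d = - e (u'.a + v'.b) modulo the image of that deformed plane. *)
Definition transversal_zeros (B : 'M[K]_7)
    (gam : {linear 'cV[K]_7 -> 'M[K]_8}) (d : 'cV[K]_8) : Prop :=
  forall (u v : 'cV[K]_7) (a b : 'cV[K]_8),
    OG27 B <<[:: u; v]>>%VS -> d = gam u *m a + gam v *m b ->
  forall psi : 'cV[K]_8, exists u' v' : 'cV[K]_7,
    [/\ polar B u u' = 0, polar B v v' = 0, polar B u v' + polar B v u' = 0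
      & psi - (gam u' *m a + gam v' *m b)
          \in clifford_image gam <<[:: u; v]>>%VS].

End SpinorBundle.

Section AdjointVariety.
Context {K : fieldType}.

(* Octonions by Cayley-Dickson doubling of the quaternions.  Over K = C the
   latter are 'M[K]_2, with the adjugate as conjugation. *)
Definition octonion : vectType K := ('M[K]_2 * 'M[K]_2)%type.

Definition oct_mul (x y : octonion) : octonion :=
  (x.1 *m y.1 - \adj y.2 *m x.2, y.2 *m x.1 + x.2 *m \adj y.1).

(* The group G_2, as the automorphism group of the octonions. *)
Definition inG2 (g : 'End(octonion)) : Prop :=
  lker g = 0%VS /\ forall x y, g (oct_mul x y) = oct_mul (g x) (g y).

(* Its Lie algebra. *)
Definition in_g2 (D : 'End(octonion)) : Prop :=
  forall x y, D (oct_mul x y) = oct_mul (D x) y + oct_mul x (D y).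

Definition Ad (g D : 'End(octonion)) : 'End(octonion) :=
  (g \o D \o g^-1)%VF.

(* X is a closed G_2-orbit in P(g_2).  There is exactly one, as g_2 is an
   irreducible representation: the orbit G_2/P_2 of the long root lines. *)
Definition is_adjoint_variety (X : {vspace 'End(octonion)} -> Prop) : Prop :=
  zariski_closed X /\
  exists D, [/\ in_g2 D, D != 0
    & forall L, X L <-> exists2 g, inG2 g & L = <[Ad g D]>%VS].

End AdjointVariety.

(* A property of a general point of K^n: it holds on some non-empty Zariski
   open subset (one may shrink it to the complement of a hypersurface). *)
Definition for_general {K : fieldType} (n : nat) (P : 'cV[K]_n -> Prop) : Prop :=
  exists2 F : {mpoly K[n]}, F != 0 &
    forall d : 'cV[K]_n, F.@[fun i => d i 0] != 0 -> P d.

(* Main.v *)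
Require Import Defs.
From HB Require Import structures.
From mathcomp Require Import all_boot all_order all_algebra.
From mathcomp Require Import reals complex mpoly ring.

(* After choosing a Clifford eigenvector, the spin representation becomes the
   octonion algebra O, a vector v acting as left multiplication by an imaginary
   octonion iota v; composing with reflections moves any spinor d with nonzero
   norm to the unit 1.  For such d, the section vanishes at an isotropic plane
   <u, v> exactly when u.v.d = 0, that is, when iota u * iota v = 0.  Such a null
   plane <x, y> of O gives the derivation z |-> P(y, z) x - P(x, z) y, with P the
   polar form of the norm, and this rule is induced by an injective linear map
   from the exterior square of K^7 to End(O); hence it suffices to identify its
   image.  A derivation D with D^2 = 0 satisfies D x * D y = 0, so its image is a
   null plane and D is, up to a scalar, of the above form.  So the lines spanned
   by nonzero square-zero derivations form the image, which is visibly closed.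
   They form one orbit because G_2 is transitive on pairs (x, y) spanning a null
   plane: x lies in a quaternion subalgebra orthogonal to y, and doubling it
   rebuilds O around (x, y). *)

Set Implicit Arguments.
Unset Strict Implicit.
Unset Printing Implicit Defensive.

Import GRing.Theory Num.Theory.
Local Open Scope ring_scope.

(** * Octonions in coordinates *)

Section Octonions.
Context {K : fieldType}.
Local Notation O := (@octonion K).
Implicit Types (k : K) (x y z : O).

(** In a Clifford module a product of two orthogonal generators is never a third one, so the
    octonion table can hold only at a well-chosen vector. The products of three generators along
    lines of the Fano plane are commuting involutions; on a common eigenvector the table holds up to
    signs, and these disappear after changing the signs of some generators. Transitivity on null
    pairs is used well beyond the orbit statement: the derivation property, the kernel of x (y z)
    and the transversality of the zeros are all checked in coordinates at the single pair ([oct_u0],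
    [oct_v0]) and transported by G_2. An injective linear map between the ambient spaces is given by
    linear forms, and so is its inverse on the image; hence the comparison of the two varieties
    needs no local charts. *)

Definition mx2 (a b c d : K) : 'M[K]_2 :=
  \matrix_(i < 2, j < 2)
    if i == 0 then (if j == 0 then a else b) else (if j == 0 then c else d).

Lemma mx2P (A B : 'M[K]_2) :
  A 0 0 = B 0 0 -> A 0 1 = B 0 1 -> A 1 0 = B 1 0 -> A 1 1 = B 1 1 -> A = B.
Proof.
have ord2 (i : 'I_2) : i = 0 \/ i = 1.
  by case: i => [[|[|//]] ?]; [left|right]; apply: val_inj.
move=> h1 h2 h3 h4; apply/matrixP => i j.
by case: (ord2 i) => ->; case: (ord2 j) => ->.
Qed.

Lemma mx2E (A : 'M[K]_2) : A = mx2 (A 0 0) (A 0 1) (A 1 0) (A 1 1).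
Proof. by apply: mx2P; rewrite !mxE. Qed.

Lemma mx2M a b c d a' b' c' d' :
  mx2 a b c d *m mx2 a' b' c' d' =
  mx2 (a * a' + b * c') (a * b' + b * d') (c * a' + d * c') (c * b' + d * d').
Proof.
by apply: mx2P; rewrite !mxE !big_ord_recr big_ord0 /= add0r !mxE.
Qed.

Lemma mx2_adj a b c d : \adj (mx2 a b c d) = mx2 d (- b) (- c) a.
Proof.
apply: mx2P; rewrite !mxE /cofactor det_mx11 !mxE /= ?mul1r //.
all: by rewrite ?addn0 ?add0n ?expr1 ?mulN1r // -signr_odd /= mul1r.
Qed.

Definition oc (a b c d e f g h : K) : O := (mx2 a b c d, mx2 e f g h).

Variant oct_spec : O -> Type :=
  OctSpec a b c d e f g h : oct_spec (oc a b c d e f g h).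

Lemma octP (x : O) : oct_spec x.
Proof. by case: x => x1 x2; rewrite (mx2E x1) (mx2E x2); apply: OctSpec. Qed.

Lemma ocM a b c d e f g h a' b' c' d' e' f' g' h' :
  oct_mul (oc a b c d e f g h) (oc a' b' c' d' e' f' g' h') =
  oc (a * a' + b * c' - (h' * e - f' * g)) (a * b' + b * d' - (h' * f - f' * h))
     (c * a' + d * c' - (e' * g - g' * e)) (c * b' + d * d' - (e' * h - g' * f))
     (e' * a + f' * c + (e * d' - f * c')) (e' * b + f' * d + (f * a' - e * b'))
     (g' * a + h' * c + (g * d' - h * c')) (g' * b + h' * d + (h * a' - g * b')).
Proof.
rewrite /oct_mul /oc /= !mx2_adj !mx2M; congr pair; apply: mx2P; rewrite !mxE /=; ring.
Qed.

Lemma ocD a b c d e f g h a' b' c' d' e' f' g' h' :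
  oc a b c d e f g h + oc a' b' c' d' e' f' g' h' =
  oc (a + a') (b + b') (c + c') (d + d') (e + e') (f + f') (g + g') (h + h').
Proof. by congr pair; apply: mx2P; rewrite !mxE. Qed.

Lemma ocZ k a b c d e f g h :
  k *: oc a b c d e f g h =
  oc (k * a) (k * b) (k * c) (k * d) (k * e) (k * f) (k * g) (k * h).
Proof. by congr pair; apply: mx2P; rewrite !mxE. Qed.

Lemma ocN a b c d e f g h :
  - oc a b c d e f g h = oc (- a) (- b) (- c) (- d) (- e) (- f) (- g) (- h).
Proof. by congr pair; apply: mx2P; rewrite !mxE. Qed.

Lemma oc0 : 0 = oc 0 0 0 0 0 0 0 0.
Proof. by congr pair; apply: mx2P; rewrite !mxE. Qed.

Definition oct1 : O := oc 1 0 0 1 0 0 0 0.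

Definition oct_norm (x : O) : K :=
  x.1 0 0 * x.1 1 1 - x.1 0 1 * x.1 1 0 + (x.2 0 0 * x.2 1 1 - x.2 0 1 * x.2 1 0).

(** No factor 1/2 here, so that [oct_polar x x] is twice the norm, whereas [polar B v v] is the
    quadratic form itself; this is the origin of the factor 2 in [frame_polar]. *)
Definition oct_polar (x y : O) : K :=
  oct_norm (x + y) - oct_norm x - oct_norm y.

Definition oct_tr (x : O) : K := x.1 0 0 + x.1 1 1.

Definition oct_conj (x : O) : O := oct_tr x *: oct1 - x.

Lemma oct_normE a b c d e f g h :
  oct_norm (oc a b c d e f g h) = a * d - b * c + (e * h - f * g).
Proof. by rewrite /oct_norm !mxE. Qed.

Lemma oct_trE a b c d e f g h : oct_tr (oc a b c d e f g h) = a + d.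
Proof. by rewrite /oct_tr !mxE. Qed.

Lemma oct_polarE a b c d e f g h a' b' c' d' e' f' g' h' :
  oct_polar (oc a b c d e f g h) (oc a' b' c' d' e' f' g' h') =
  a * d' + d * a' - b * c' - c * b' + (e * h' + h * e' - f * g' - g * f').
Proof. rewrite /oct_polar ocD !oct_normE; ring. Qed.

Lemma oc_inj a b c d e f g h a' b' c' d' e' f' g' h' :
  oc a b c d e f g h = oc a' b' c' d' e' f' g' h' ->
  [/\ a = a', b = b', c = c' & d = d'] /\ [/\ e = e', f = f', g = g' & h = h'].
Proof.
have mx2_inj p q r s p' q' r' s' : mx2 p q r s = mx2 p' q' r' s' ->
    [/\ p = p', q = q', r = r' & s = s'].
  move=> E; split.
  - by have := congr1 (fun A : 'M_2 => A 0 0) E; rewrite !mxE.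
  - by have := congr1 (fun A : 'M_2 => A 0 1) E; rewrite !mxE.
  - by have := congr1 (fun A : 'M_2 => A 1 0) E; rewrite !mxE.
  - by have := congr1 (fun A : 'M_2 => A 1 1) E; rewrite !mxE.
by case=> /mx2_inj ? /mx2_inj.
Qed.

End Octonions.

(** Octonion identities are proved by reduction to one ring identity per coordinate. *)
Ltac ocsimp := rewrite /oct_conj /oct1 ?oc0;
  rewrite ?(ocM, ocD, ocZ, ocN, oct_normE, oct_trE, oct_polarE).
Ltac ocring := ocsimp; try congr oc; ring.

Section OctonionIdentities.
Context {K : fieldType}.
Local Notation O := (@octonion K).
Implicit Types (k : K) (x y z : O).

Lemma oct_mulDl x y z : oct_mul (x + y) z = oct_mul x z + oct_mul y z.
Proof. case: (octP x) (octP y) (octP z)=> ????????[????????][????????]; ocring. Qed.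
Lemma oct_mulDr x y z : oct_mul x (y + z) = oct_mul x y + oct_mul x z.
Proof. case: (octP x) (octP y) (octP z)=> ????????[????????][????????]; ocring. Qed.
Lemma oct_mulZl k x y : oct_mul (k *: x) y = k *: oct_mul x y.
Proof. case: (octP x) (octP y)=> ????????[????????]; ocring. Qed.
Lemma oct_mulZr k x y : oct_mul x (k *: y) = k *: oct_mul x y.
Proof. case: (octP x) (octP y)=> ????????[????????]; ocring. Qed.
Lemma oct_mulNl x y : oct_mul (- x) y = - oct_mul x y.
Proof. by rewrite -scaleN1r oct_mulZl scaleN1r. Qed.
Lemma oct_mulNr x y : oct_mul x (- y) = - oct_mul x y.
Proof. by rewrite -scaleN1r oct_mulZr scaleN1r. Qed.
Lemma oct_mulBl x y z : oct_mul (x - y) z = oct_mul x z - oct_mul y z.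
Proof. by rewrite oct_mulDl oct_mulNl. Qed.
Lemma oct_mulBr x y z : oct_mul x (y - z) = oct_mul x y - oct_mul x z.
Proof. by rewrite oct_mulDr oct_mulNr. Qed.
Lemma oct_mul0l x : oct_mul 0 x = 0.
Proof. by rewrite -(scale0r 0) oct_mulZl !scale0r. Qed.
Lemma oct_mul0r x : oct_mul x 0 = 0.
Proof. by rewrite -(scale0r 0) oct_mulZr !scale0r. Qed.
Lemma oct_mul1l x : oct_mul oct1 x = x.
Proof. case: (octP x)=> ????????; ocring. Qed.
Lemma oct_mul1r x : oct_mul x oct1 = x.
Proof. case: (octP x)=> ????????; ocring. Qed.

Lemma oct_polarC x y : oct_polar x y = oct_polar y x.
Proof. rewrite /oct_polar (addrC x); ring. Qed.
Lemma oct_polarDl x y z : oct_polar (x + y) z = oct_polar x z + oct_polar y z.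
Proof. case: (octP x) (octP y) (octP z)=> ????????[????????][????????]; ocring. Qed.
Lemma oct_polarZl k x y : oct_polar (k *: x) y = k * oct_polar x y.
Proof. case: (octP x) (octP y)=> ????????[????????]; ocring. Qed.
Lemma oct_polarDr x y z : oct_polar x (y + z) = oct_polar x y + oct_polar x z.
Proof. by rewrite oct_polarC oct_polarDl !(oct_polarC x). Qed.
Lemma oct_polarZr k x y : oct_polar x (k *: y) = k * oct_polar x y.
Proof. by rewrite oct_polarC oct_polarZl oct_polarC. Qed.
Lemma oct_polarNl x y : oct_polar (- x) y = - oct_polar x y.
Proof. by rewrite -scaleN1r oct_polarZl mulN1r. Qed.
Lemma oct_polarNr x y : oct_polar x (- y) = - oct_polar x y.
Proof. by rewrite -scaleN1r oct_polarZr mulN1r. Qed.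
Lemma oct_polar0l x : oct_polar 0 x = 0.
Proof. by rewrite -(scale0r 0) oct_polarZl mul0r. Qed.
Lemma oct_polar_tr x : oct_polar x oct1 = oct_tr x.
Proof. case: (octP x)=> ????????; ocring. Qed.
Lemma oct_polarxx x : oct_polar x x = oct_norm x *+ 2.
Proof. case: (octP x)=> ????????; ocring. Qed.

Lemma oct_trD x y : oct_tr (x + y) = oct_tr x + oct_tr y.
Proof. case: (octP x) (octP y)=> ????????[????????]; ocring. Qed.
Lemma oct_trZ k x : oct_tr (k *: x) = k * oct_tr x.
Proof. case: (octP x)=> ????????; ocring. Qed.
Lemma oct_trN x : oct_tr (- x) = - oct_tr x.
Proof. case: (octP x)=> ????????; ocring. Qed.
Lemma oct_normD x y : oct_norm (x + y) = oct_norm x + oct_norm y + oct_polar x y.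
Proof. by rewrite /oct_polar; ring. Qed.
Lemma oct_normZ k x : oct_norm (k *: x) = k ^+ 2 * oct_norm x.
Proof. case: (octP x)=> ????????; ocring. Qed.

Lemma oct_sqr x : oct_mul x x = oct_tr x *: x - oct_norm x *: oct1.
Proof. case: (octP x)=> ????????; ocring. Qed.
Lemma oct_mulC x y :
  oct_mul x y + oct_mul y x =
  oct_tr x *: y + oct_tr y *: x - oct_polar x y *: oct1.
Proof. case: (octP x) (octP y)=> ????????[????????]; ocring. Qed.

Lemma oct_norm_mul x y : oct_norm (oct_mul x y) = oct_norm x * oct_norm y.
Proof. case: (octP x) (octP y)=> ????????[????????]; ocring. Qed.

(** Polarization of x (conj(x) z) = N(x) z. For imaginary x and y it is a Clifford relation: left
    multiplications by orthogonal imaginary octonions anticommute. *)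
Lemma oct_altl x y z :
  oct_mul x (oct_mul (oct_conj y) z) + oct_mul y (oct_mul (oct_conj x) z) =
  oct_polar x y *: z.
Proof. case: (octP x) (octP y) (octP z)=> ????????[????????][????????]; ocring. Qed.
Lemma oct_altr x y z :
  oct_mul (oct_mul z x) (oct_conj y) + oct_mul (oct_mul z y) (oct_conj x) =
  oct_polar x y *: z.
Proof. case: (octP x) (octP y) (octP z)=> ????????[????????][????????]; ocring. Qed.
Lemma oct_flex x y : oct_mul (oct_mul x y) x = oct_mul x (oct_mul y x).
Proof. case: (octP x) (octP y)=> ????????[????????]; ocring. Qed.
Lemma oct_adjl x y z :
  oct_polar (oct_mul x y) z = oct_polar y (oct_mul (oct_conj x) z).
Proof. case: (octP x) (octP y) (octP z)=> ????????[????????][????????]; ocring. Qed.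
Lemma oct_moufang x y z :
  oct_mul (oct_mul x y) (oct_mul z x) = oct_mul x (oct_mul (oct_mul y z) x).
Proof. case: (octP x) (octP y) (octP z)=> ????????[????????][????????]; ocring. Qed.

End OctonionIdentities.

Lemma exists_lfun (F : fieldType) (aT rT : vectType F) (f : aT -> rT) :
  linear f -> exists g : 'Hom(aT, rT), g =1 f.
Proof.
move=> f_lin.
pose fL : {linear aT -> rT} := HB.pack f (GRing.isLinear.Build _ _ _ _ f f_lin).
by exists (linfun fL) => x; rewrite lfunE.
Qed.

(** * Cayley-Dickson doubling of a quaternion subalgebra of O *)

Section Doubling.
Context {K : fieldType}.
Local Notation O := (@octonion K).
Implicit Types (a b c : O).

Lemma oct_conjK a : oct_conj (oct_conj a) = a.
Proof. case: (octP a) => *; ocring. Qed.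

Lemma oct_conj_imag a : oct_tr a = 0 -> oct_conj a = - a.
Proof. by move=> a0; rewrite /oct_conj a0 scale0r sub0r. Qed.

Lemma oct_conj_mull a : oct_mul (oct_conj a) a = oct_norm a *: oct1.
Proof. case: (octP a) => *; ocring. Qed.

Lemma oct_alt a b : oct_mul a (oct_mul a b) = oct_mul (oct_mul a a) b.
Proof. case: (octP a) (octP b) => ????????[????????]; ocring. Qed.

Lemma oct_altR a b : oct_mul (oct_mul b a) a = oct_mul b (oct_mul a a).
Proof. case: (octP a) (octP b) => ????????[????????]; ocring. Qed.

Lemma oct_polar_mulr a b c :
  oct_polar (oct_mul a c) (oct_mul b c) = oct_norm c * oct_polar a b.
Proof. case: (octP a) (octP b) (octP c) => ????????[????????][????????]; ocring. Qed.

Lemma oct_polar_mull a b c :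
  oct_polar (oct_mul c a) (oct_mul c b) = oct_norm c * oct_polar a b.
Proof. case: (octP a) (octP b) (octP c) => ????????[????????][????????]; ocring. Qed.

Lemma oct_nondegenerate a : a != 0 -> exists b, oct_polar a b != 0.
Proof.
case: (octP a) => p q r s p' q' r' s' a0.
pose vanish b := oct_polar (oc p q r s p' q' r' s') b == 0.
(* Pairing with these eight elements reads off the coordinates of [a] up to sign. *)
have [|/allPn[b _ nb]] := boolP (all vanish
  [:: oc 0 0 0 1 0 0 0 0; oc 1 0 0 0 0 0 0 0; oc 0 0 1 0 0 0 0 0;
      oc 0 1 0 0 0 0 0 0; oc 0 0 0 0 0 0 0 1; oc 0 0 0 0 1 0 0 0;
      oc 0 0 0 0 0 0 1 0; oc 0 0 0 0 0 1 0 0]); last by exists b.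
rewrite /= /vanish !oct_polarE.
rewrite !(mulr0, mulr1, oppr0, addr0, add0r, oppr_eq0, andbT).
move=> /and5P[/eqP p0 /eqP s0 /eqP q0 /eqP r0].
move=> /and4P[/eqP p'0 /eqP s'0 /eqP q'0 /eqP r'0].
by case/eqP: a0; rewrite p0 q0 r0 s0 p'0 q'0 r'0 s'0 -oc0.
Qed.

Section CayleyDickson.
Variables (h : {linear 'M[K]_2 -> O}) (l : O).
Hypothesis h1 : h 1%:M = oct1.
Hypothesis hM : forall x y, h (x *m y) = oct_mul (h x) (h y).
Hypothesis h_adj : forall x, h (\adj x) = oct_conj (h x).
Hypothesis h_orth : forall x, oct_polar (h x) l = 0.
Hypothesis l_norm : oct_norm l = 1.

Let l_tr : oct_tr l = 0.
Proof. by rewrite -oct_polar_tr -h1 oct_polarC h_orth. Qed.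

(** As [l] is orthogonal to 1 and to [h x], the formula for x l + l x reduces to tr(x) l. *)
Let hl x : oct_mul (h x) l = oct_mul l (h (\adj x)).
Proof.
have := oct_mulC (h x) l; rewrite l_tr h_orth !scale0r subr0 addr0.
move/(canRL (addrK _)) => ->.
by rewrite h_adj /oct_conj oct_mulBr oct_mulZr oct_mul1r.
Qed.

Let adjK (x : 'M[K]_2) : \adj (\adj x) = x.
Proof. by rewrite (mx2E x) !mx2_adj !opprK. Qed.

Let adjM (x y : 'M[K]_2) : \adj (x *m y) = \adj y *m \adj x.
Proof.
rewrite (mx2E x) (mx2E y) !(mx2M, mx2_adj).
by apply: mx2P; rewrite !mxE /=; ring.
Qed.

(** With the pair (a, b) read as a + b l, [oct_mul] is the product forced by the rules for moving
    [l] past the quaternions. *)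
Definition doubling (x : O) : O := h x.1 + oct_mul (h x.2) l.

Lemma doubling_linear : linear doubling.
Proof.
move=> k [x1 x2] [y1 y2].
by rewrite /doubling /= !linearP oct_mulDl oct_mulZl scalerDr addrACA.
Qed.

(* [a (b l) = (b a) l], [(a l) b = (a (conj b)) l] and [(a l) (b l) = - (conj b) a] for
   [a], [b] in the quaternion subalgebra [h 'M_2] and [l] orthogonal to it. *)
Lemma doublingM (x y : O) :
  doubling (oct_mul x y) = oct_mul (doubling x) (doubling y).
Proof.
have mul1 (a b : 'M_2) : oct_mul (h a) (oct_mul (h b) l) = oct_mul (h (b *m a)) l.
  have := oct_altl (h a) l (h (\adj b)).
  rewrite h_orth scale0r (oct_conj_imag l_tr) oct_mulNl oct_mulNr addrC.
  move/eqP; rewrite subr_eq0 eq_sym => /eqP E.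
  by rewrite !hl E -h_adj -hM adjM.
have mul2 (a b : 'M_2) : oct_mul (oct_mul (h a) l) (h b) = oct_mul (h (a *m \adj b)) l.
  have := oct_altr l (h (\adj b)) (h a).
  rewrite oct_polarC h_orth scale0r (oct_conj_imag l_tr) oct_mulNr -h_adj adjK.
  by move/eqP; rewrite subr_eq0 -hM => /eqP.
(* Writing a l as l conj(a) gives the left side of the Moufang identity; moving the last [l] to the
   front then leaves l (l z) = - z. *)
have mul3 (a b : 'M_2) : oct_mul (oct_mul (h a) l) (oct_mul (h b) l) = - h (\adj b *m a).
  rewrite hl oct_moufang -hM hl oct_alt oct_sqr l_tr l_norm scale0r scale1r.
  by rewrite sub0r oct_mulNl oct_mul1l adjM adjK.
rewrite /doubling !oct_mulDl !oct_mulDr mul1 mul2 mul3 [oct_mul x y]/oct_mul /=.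
rewrite (raddfB h) (raddfD h).
rewrite -!hM. rewrite oct_mulDl -!addrA; congr (_ + _); rewrite addrC -!addrA; congr (_ + _).
Qed.

End CayleyDickson.
End Doubling.

Lemma free2P (F : fieldType) (vT : vectType F) (u v : vT) :
  reflect (forall a b, a *: u + b *: v = 0 -> a = 0 /\ b = 0) (free [:: u; v]).
Proof.
rewrite free_cons free_cons nil_free span_seq1 span_nil memv0 andbT.
apply: (iffP andP) => [[/vlineP uv v0] a b ab0|H].
  have a0 : a = 0.
    apply/eqP; apply/negPn/negP => a0; apply: uv; exists (- (a^-1 * b)).
    apply: (scalerI a0); rewrite scalerA mulrN mulrA divff // mul1r.
    by apply/eqP; rewrite scaleNr -addr_eq0; apply/eqP.
  split=> //; move: ab0; rewrite a0 scale0r add0r => /eqP.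
  by rewrite scaler_eq0 (negPf v0) orbF => /eqP.
split.
  apply/vlineP => -[k uk]; have := H 1 (- k).
  rewrite uk scale1r scaleNr subrr => /(_ erefl)[/eqP].
  by rewrite oner_eq0.
apply/eqP => v0; have := H 0 1.
by rewrite v0 scaler0 scale0r addr0 => /(_ erefl)[_ /eqP]; rewrite oner_eq0.
Qed.

(** * Transitivity of G_2 on null pairs *)

Section NullPairs.
Context {K : numFieldType}.
Local Notation O := (@octonion K).
Implicit Types (u v w x y : O).

Definition null_pair (u v : O) : Prop :=
  [/\ oct_tr u = 0, oct_tr v = 0, oct_mul u v = 0 & free [:: u; v]].

Lemma oct_sqr_imag x : oct_tr x = 0 -> oct_mul x x = - oct_norm x *: oct1.
Proof. by move=> x0; rewrite oct_sqr x0 scale0r sub0r scaleNr. Qed.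

Lemma oct1_neq0 : oct1 != 0 :> O.
Proof.
apply/eqP; rewrite oc0 => /oc_inj[[/eqP]]; by rewrite oner_eq0.
Qed.

(** Alternativity gives 0 = u (u v) = - N(u) v, and N(v) = 0 in the same way. Then v u is the scalar
    - P(u, v), which vanishes because v (v u) = - N(v) u = 0. *)
Lemma null_pair_norm u v : null_pair u v ->
  [/\ oct_norm u = 0, oct_norm v = 0, oct_polar u v = 0 & oct_mul v u = 0].
Proof.
case=> tu tv uv uv_free.
have u0 : u != 0 by apply: (free_not0 uv_free); rewrite inE eqxx.
have v0 : v != 0 by apply: (free_not0 uv_free); rewrite !inE eqxx orbT.
have nu : oct_norm u = 0.
  have := oct_alt u v; rewrite uv oct_mul0r oct_sqr_imag // oct_mulZl oct_mul1l.
  by move/esym/eqP; rewrite scaler_eq0 (negPf v0) orbF oppr_eq0 => /eqP.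
have nv : oct_norm v = 0.
  have := oct_altR v u; rewrite uv oct_mul0l oct_sqr_imag // oct_mulZr oct_mul1r.
  by move/esym/eqP; rewrite scaler_eq0 (negPf u0) orbF oppr_eq0 => /eqP.
have vu : oct_mul v u = - oct_polar u v *: oct1.
  by have := oct_mulC u v; rewrite uv tu tv !scale0r !add0r scaleNr.
have Puv : oct_polar u v = 0.
  have := oct_alt v u; rewrite vu oct_sqr_imag // nv oppr0 scale0r oct_mul0l.
  rewrite oct_mulZr oct_mul1r => /eqP.
  by rewrite scaler_eq0 (negPf v0) orbF oppr_eq0 => /eqP.
by split=> //; rewrite vu Puv oppr0 scale0r.
Qed.

(** Together with [u], the vector [w] generates a copy of the 2 x 2 matrices orthogonal to [v]; the
    value -1 is the pairing of the matrix units E12 and E21. *)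
Lemma null_pair_dual u v : null_pair u v -> exists w,
  [/\ oct_tr w = 0, oct_norm w = 0, oct_polar u w = -1 & oct_polar v w = 0].
Proof.
move=> uv; have [nu nv Puv _] := null_pair_norm uv.
have [tu tv _ uv_free] := uv.
have v0 : v != 0 by apply: (free_not0 uv_free); rewrite !inE eqxx orbT.
have [y0 vy0] := oct_nondegenerate v0.
(* Nonzero by independence. For [y] not orthogonal to [z], the pairings of u, v with y, y0 have
   nonzero determinant, and this determinant is P(u, w0). *)
pose z := oct_polar v y0 *: u - oct_polar u y0 *: v.
have [|y zy] := @oct_nondegenerate K z.
  apply/eqP; rewrite /z -scaleNr => /(free2P _ _ uv_free)[/eqP].
  by rewrite (negPf vy0).
pose w0 := oct_polar v y0 *: y - oct_polar v y *: y0.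
have vw0 : oct_polar v w0 = 0.
  by rewrite oct_polarDr oct_polarNr !oct_polarZr mulrC subrr.
have uw0 : oct_polar u w0 != 0.
  move: zy; rewrite /z /w0 oct_polarDl oct_polarDr oct_polarNl oct_polarNr.
  by rewrite !oct_polarZl !oct_polarZr (mulrC (oct_polar u y0)).
clearbody w0.
pose w1 := - (oct_polar u w0)^-1 *: (w0 - (oct_tr w0 / 2) *: oct1).
have uw1 : oct_polar u w1 = -1.
  rewrite oct_polarZr oct_polarDr oct_polarNr oct_polarZr oct_polar_tr tu mulr0.
  by rewrite subr0 mulNr mulVf.
have vw1 : oct_polar v w1 = 0.
  rewrite oct_polarZr oct_polarDr oct_polarNr oct_polarZr oct_polar_tr tv mulr0.
  by rewrite vw0 subr0 mulr0.
have tw1 : oct_tr w1 = 0.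
  rewrite oct_trZ oct_trD oct_trN oct_trZ oct_trE -(natrD _ 1 1) divfK ?pnatr_eq0 //.
  by rewrite subrr mulr0.
clearbody w1.
(* As u is isotropic and P(u, w1) = -1, adding t u to w1 lowers the norm by t. *)
exists (w1 + oct_norm w1 *: u); split.
- by rewrite oct_trD oct_trZ tw1 tu mulr0 addr0.
- rewrite oct_normD oct_normZ nu mulr0 addr0 oct_polarZr oct_polarC uw1.
  by rewrite mulrN1 subrr.
- by rewrite oct_polarDr oct_polarZr oct_polarxx nu mul0rn mulr0 addr0.
- by rewrite oct_polarDr oct_polarZr vw1 (oct_polarC v u) Puv mulr0 addr0.
Qed.


Section QuaternionFrame.
Variables u w : O.
Hypotheses (tu : oct_tr u = 0) (tw : oct_tr w = 0).
Hypotheses (nu : oct_norm u = 0) (nw : oct_norm w = 0).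
Hypothesis uw1 : oct_polar u w = -1.

Let p := oct_mul u w.
Let q := oct_mul w u.

(** The images of the matrix units: u and w are E12 and E21, so p = u w and q = w u are
    complementary idempotents, E11 and E22. *)
Definition quat_frame (x : 'M[K]_2) : O :=
  x 0 0 *: p + x 0 1 *: u + x 1 0 *: w + x 1 1 *: q.

Lemma quat_frame_linear : linear quat_frame.
Proof.
move=> k /= x y; rewrite /quat_frame !mxE !scalerDl !scalerDr !scalerA.
move: (_ *: p) (_ *: p) (_ *: u) (_ *: u) (_ *: w) (_ *: w) (_ *: q) (_ *: q).
case=> a1 a2 [b1 b2] [c1 c2] [d1 d2] [e1 e2] [f1 f2] [g1 g2] [h1 h2].
by congr pair; apply/matrixP => i j; rewrite !mxE; ring.
Qed.

HB.instance Definition _ :=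
  GRing.isLinear.Build K 'M[K]_2 O *:%R quat_frame quat_frame_linear.

Let uu : oct_mul u u = 0.
Proof. by rewrite oct_sqr_imag // nu oppr0 scale0r. Qed.
Let ww : oct_mul w w = 0.
Proof. by rewrite oct_sqr_imag // nw oppr0 scale0r. Qed.
Let pq : p + q = oct1.
Proof.
have := oct_mulC u w; rewrite uw1 tu tw !scale0r !add0r scaleN1r opprK.
exact.
Qed.
Let qE : q = oct1 - p.
Proof. by rewrite -pq addrC addKr. Qed.
Let tp : oct_tr p = 1.
Proof.
rewrite -oct_polar_tr oct_adjl oct_mul1r oct_conj_imag // oct_polarNr.
by rewrite oct_polarC uw1 opprK.
Qed.
Let pp : oct_mul p p = p.
Proof. by rewrite oct_sqr tp /p oct_norm_mul nu mul0r scale0r scale1r subr0. Qed.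
Let up : oct_mul u p = 0.
Proof. by rewrite oct_alt uu oct_mul0l. Qed.
Let pw : oct_mul p w = 0.
Proof. by rewrite oct_altR ww oct_mul0r. Qed.
Let uq : oct_mul u q = u.
Proof. by rewrite qE oct_mulBr oct_mul1r up subr0. Qed.
Let pu : oct_mul p u = u.
Proof. by rewrite oct_flex. Qed.
Let qu : oct_mul q u = 0.
Proof. by rewrite qE oct_mulBl oct_mul1l pu subrr. Qed.
Let qw : oct_mul q w = w.
Proof. by rewrite qE oct_mulBl oct_mul1l pw subr0. Qed.
Let wp : oct_mul w p = w.
Proof. by rewrite -oct_flex. Qed.
Let wq : oct_mul w q = 0.
Proof. by rewrite qE oct_mulBr oct_mul1r wp subrr. Qed.
Let pqM : oct_mul p q = 0.
Proof. by rewrite qE oct_mulBr oct_mul1r pp subrr. Qed.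
Let qp : oct_mul q p = 0.
Proof. by rewrite qE oct_mulBl oct_mul1l pp subrr. Qed.
Let qq : oct_mul q q = q.
Proof. by rewrite {2}qE oct_mulBr oct_mul1r qp subr0. Qed.

Lemma quat_frame1 : quat_frame 1%:M = oct1.
Proof. by rewrite /quat_frame !mxE /= !scale0r !scale1r !addr0. Qed.

Lemma quat_frameM (x y : 'M[K]_2) :
  quat_frame (x *m y) = oct_mul (quat_frame x) (quat_frame y).
Proof.
rewrite (mx2E x) (mx2E y) mx2M /quat_frame !mxE /=.
(* Only the table of the sixteen products of matrix units is kept; p and q become variables, and the
   rest is bilinear expansion. *)
move: pp pu pw pqM up uu uq (erefl p : oct_mul u w = p).
move: wp (erefl q : oct_mul w u = q) ww wq qp qu qw qq; move: (p) (q) => p' q'.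
do 16 move=> ?.
move: (x 0 0) (x 0 1) (x 1 0) (x 1 1) => x1 x2 x3 x4.
move: (y 0 0) (y 0 1) (y 1 0) (y 1 1) => y1 y2 y3 y4.
rewrite !oct_mulDl !oct_mulDr !oct_mulZl !oct_mulZr.
do 16 match goal with H : oct_mul _ _ = _ |- _ => rewrite H {H} end.
case: (p') (q') (u) (w) => p1 p2 [q1 q2] [u1 u2] [w1 w2].
by congr pair; apply/matrixP => i j; rewrite !mxE; ring.
Qed.

Lemma quat_frame_adj (x : 'M[K]_2) : quat_frame (\adj x) = oct_conj (quat_frame x).
Proof.
rewrite (mx2E x) mx2_adj /quat_frame !mxE /= /oct_conj.
move: (x 0 0) (x 0 1) (x 1 0) (x 1 1) => x1 x2 x3 x4.
have tq : oct_tr q = 1 by rewrite qE oct_trD oct_trN tp oct_trE addrK.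
rewrite !oct_trD !oct_trZ tp tq tu tw !mulr0 !addr0 !mulr1 -pq.
case: p => p1 p2; case: q => q1 q2; case: (u) => u1 u2; case: (w) => w1 w2.
by congr pair; apply/matrixP => i j; rewrite !mxE; ring.
Qed.

Lemma quat_frame_orth (x : 'M[K]_2) y :
  oct_polar p y = 0 -> oct_polar u y = 0 -> oct_polar w y = 0 -> oct_polar q y = 0 ->
  oct_polar (quat_frame x) y = 0.
Proof.
by move=> h1 h2 h3 h4; rewrite !oct_polarDl !oct_polarZl h1 h2 h3 h4 !mulr0 !addr0.
Qed.

Lemma quat_frame_proj y : exists x : 'M[K]_2,
  forall x' : 'M[K]_2, oct_polar (quat_frame x') (y - quat_frame x) = 0.
Proof.
have Pup : oct_polar u p = 0 by rewrite -[u in LHS]oct_mul1r oct_polar_mull nu mul0r.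
have Puq : oct_polar u q = 0 by rewrite -[u in LHS]oct_mul1l oct_polar_mulr nu mul0r.
have Pwp : oct_polar w p = 0 by rewrite -[w in LHS]oct_mul1l oct_polar_mulr nw mul0r.
have Pwq : oct_polar w q = 0 by rewrite -[w in LHS]oct_mul1r oct_polar_mull nw mul0r.
have Ppp : oct_polar p p = 0 by rewrite oct_polarxx oct_norm_mul nu mul0r mul0rn.
have Ppq : oct_polar p q = 1.
  by rewrite qE oct_polarDr oct_polarNr Ppp subr0 oct_polar_tr tp.
have Pqq : oct_polar q q = 0 by rewrite oct_polarxx oct_norm_mul nu mulr0 mul0rn.
(* The coordinates of the orthogonal projection: for P the basis p, u, w, q has dual basis q, -w,
   -u, p. *)
exists (mx2 (oct_polar q y) (- oct_polar w y) (- oct_polar u y) (oct_polar p y)) => x'.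
have Puu : oct_polar u u = 0 by rewrite oct_polarxx nu mul0rn.
have Pww : oct_polar w w = 0 by rewrite oct_polarxx nw mul0rn.
apply: quat_frame_orth; rewrite oct_polarDr oct_polarNr /quat_frame !mxE /=;
  rewrite !oct_polarDr !oct_polarZr.
- by rewrite Ppp Ppq (oct_polarC p u) (oct_polarC p w) Pup Pwp; ring.
- by rewrite Pup Puu Puq uw1; ring.
- by rewrite Pwp (oct_polarC w u) Pww Pwq uw1; ring.
- by rewrite (oct_polarC q p) (oct_polarC q u) (oct_polarC q w) Ppq Puq Pwq Pqq; ring.
Qed.

End QuaternionFrame.

Lemma exists_quaternions (u w : O) :
  oct_tr u = 0 -> oct_tr w = 0 -> oct_norm u = 0 -> oct_norm w = 0 ->
  oct_polar u w = -1 -> exists h : {linear 'M[K]_2 -> O},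
  [/\ h 1%:M = oct1, forall x y : 'M[K]_2, h (x *m y) = oct_mul (h x) (h y),
      forall x : 'M[K]_2, h (\adj x) = oct_conj (h x) &
  [/\ h (mx2 0 1 0 0) = u, h (mx2 0 0 1 0) = w
    & forall y, exists x : 'M[K]_2, forall x' : 'M[K]_2,
      oct_polar (h x') (y - h x) = 0]].
Proof.
move=> tu tw nu nw uw; exists (quat_frame u w); split.
- exact: quat_frame1.
- exact: quat_frameM.
- exact: quat_frame_adj.
split; last exact: quat_frame_proj.
- by rewrite /= /quat_frame !mxE /= !scale0r scale1r !addr0 add0r.
- by rewrite /= /quat_frame !mxE /= !scale0r scale1r !addr0 add0r.
Qed.

End NullPairs.

Section Transitivity.
Context {K : numFieldType}.
Local Notation O := (@octonion K).
Implicit Types (u v w x y : O).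

(** The reference null pair: E12 in the first half and in the second. In the doubling, [oct_v0] is
    [oct_u0] times the new unit l, so an automorphism carrying the pair to (u, v) amounts to h with
    h E12 = u and l with u l = v. *)
Definition oct_u0 : O := oc 0 1 0 0 0 0 0 0.
Definition oct_v0 : O := oc 0 0 0 0 0 1 0 0.

Lemma mx20 : mx2 0 0 0 0 = 0 :> 'M[K]_2.
Proof. by apply: mx2P; rewrite !mxE. Qed.

Lemma oct_isometry_inj (g : 'End(O)) :
  (forall x, oct_norm (g x) = oct_norm x) -> lker g = 0%VS.
Proof.
move=> gN; apply/eqP; apply/lker0P => x y gxy.
apply/eqP; rewrite -subr_eq0; apply/negP => /negP /oct_nondegenerate[z].
suff -> : oct_polar (x - y) z = 0 by rewrite eqxx.
have gz : g (x - y) = 0 by rewrite linearB /= gxy subrr.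
rewrite /oct_polar -(gN (x - y + z)) -(gN (x - y)) -(gN z) linearD /= gz add0r.
by rewrite -(scale0r (0 : O)) oct_normZ expr0n mul0r subr0 subrr.
Qed.

Lemma null_pair_transitive u v : null_pair u v ->
  exists g : 'End(O), [/\ inG2 g, g oct_u0 = u & g oct_v0 = v].
Proof.
move=> uv; have [nu nv Puv vu] := null_pair_norm uv.
have [w [tw nw uw vw]] := null_pair_dual uv.
have [tu tv uv0 uv_free] := uv.
have v0 : v != 0 by apply: (free_not0 uv_free); rewrite !inE eqxx orbT.
have [h [h1 hM h_adj [hu hw h_proj]]] := exists_quaternions tu tw nu nw uw.
have pv : oct_polar (oct_mul w u) v = 0.
  have := oct_mulC u w; rewrite tu tw uw !scale0r !add0r scaleN1r opprK.
  move/(canRL (addKr _)) => ->.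
  rewrite addrC oct_polarDl oct_polarNl oct_polarC oct_polar_tr tv sub0r.
  by rewrite oct_adjl oct_conj_imag // oct_mulNl uv0 oppr0 oct_polarC oct_polar0l oppr0.
have hv (x : 'M[K]_2) : oct_polar (h x) v = 0.
  have -> : x = x 0 0 *: 1%:M + x 0 1 *: mx2 0 1 0 0 + x 1 0 *: mx2 0 0 1 0
              + (x 1 1 - x 0 0) *: (mx2 0 0 1 0 *m mx2 0 1 0 0).
    by rewrite mx2M; apply: mx2P; rewrite !mxE /=; ring.
  rewrite !linearD !linearZ /= h1 hM hu hw !oct_polarDl !oct_polarZl pv Puv.
  by rewrite [oct_polar w v]oct_polarC vw oct_polarC oct_polar_tr tv !mulr0 !addr0.
have [y0 vy0] := oct_nondegenerate v0.
(* Scaled so that P(v, y) = -1. Removing the projection to the quaternions does not change this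
   value, since [v] is orthogonal to them. *)
pose y := - (oct_polar v y0)^-1 *: y0.
have [A hA] := h_proj y.
pose s := y - h A.
have vs : oct_polar v s = -1.
  by rewrite oct_polarDr oct_polarNr (oct_polarC v (h A)) hv subr0 oct_polarZr mulNr mulVf.
(* The first term solves u l = v, because u (w v) + w (u v) = v, but it is isotropic. The second
   term is killed by u and brings the norm to P(w v, u s) = - P(v, s) = 1. Both stay orthogonal to
   the quaternions, as v and s are. *)
pose l := oct_mul w v + oct_mul u s.
have ul : oct_mul u l = v.
  rewrite oct_mulDr oct_alt oct_sqr_imag // nu oppr0 scale0r oct_mul0l addr0.
  have := oct_altl u w v; rewrite !oct_conj_imag // !oct_mulNl !oct_mulNr uv0.
  by rewrite oct_mul0r oppr0 addr0 uw scaleN1r => /oppr_inj.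
have h_orth (x : 'M[K]_2) : oct_polar (h x) l = 0.
  rewrite oct_polarDr [X in X + _]oct_polarC [X in _ + X]oct_polarC.
  rewrite !oct_adjl !oct_conj_imag // !oct_mulNl !oct_polarNr.
  by rewrite -{1}hw -{1}hu -!hM oct_polarC hv oct_polarC hA oppr0 addr0.
have nl : oct_norm l = 1.
  rewrite oct_normD !oct_norm_mul nv nu mulr0 mul0r !add0r.
  rewrite oct_polarC oct_adjl oct_conj_imag // oct_mulNl oct_polarNr.
  have -> : oct_mul u (oct_mul w v) = v.
    by rewrite -[RHS]ul oct_mulDr [X in _ + X]oct_alt oct_sqr_imag // nu oppr0
      scale0r oct_mul0l addr0.
  by rewrite oct_polarC vs opprK.
have gM := doublingM h1 hM h_adj h_orth nl.
have [g gE] := exists_lfun (doubling_linear h l).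
exists g; split.
- split; last by move=> x z; rewrite !gE gM.
  apply: oct_isometry_inj => x; rewrite gE /doubling.
  have nh (z : 'M[K]_2) : oct_norm (h z) = z 0 0 * z 1 1 - z 0 1 * z 1 0.
    have := oct_conj_mull (h z); rewrite -h_adj -hM.
    have -> : \adj z *m z = (z 0 0 * z 1 1 - z 0 1 * z 1 0) *: 1%:M.
      by rewrite (mx2E z) mx2_adj mx2M; apply: mx2P; rewrite !mxE /=; ring.
    rewrite linearZ /= h1 => /eqP; rewrite -subr_eq0 -scalerBl scaler_eq0.
    by rewrite (negPf oct1_neq0) orbF subr_eq0 => /eqP.
  rewrite oct_normD oct_norm_mul nl mulr1 !nh.
  by rewrite oct_polarC oct_adjl -h_adj -hM oct_polarC h_orth addr0.
- by rewrite gE /doubling /= hu mx20 linear0 oct_mul0l addr0.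
- by rewrite gE /doubling /= hu mx20 linear0 add0r.
Qed.


End Transitivity.

Lemma vlineZ (F : fieldType) (vT : vectType F) (k : F) (v : vT) :
  k != 0 -> <[k *: v]>%VS = <[v]>%VS.
Proof.
move=> k0; apply/eqP; rewrite eqEsubv -!memvE memvZ ?memv_line //=.
by rewrite -[v in v \in _](scalerK k0) memvZ ?memv_line.
Qed.

(** * Square-zero derivations *)

Section AdjointOrbit.
Context {K : numFieldType}.
Local Notation O := (@octonion K).
Implicit Types (u v w x y : O) (g D : 'End(O)).

Lemma inG2_mulg g x y : inG2 g -> g (oct_mul x y) = oct_mul (g x) (g y).
Proof. by case. Qed.

Lemma inG2_K g : inG2 g -> cancel g g^-1%VF.
Proof. by case=> /eqP/lker0_lfunK. Qed.

Lemma inG2_VK g : inG2 g -> cancel g^-1%VF g.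
Proof. by case=> /eqP/lker0_lfunVK. Qed.

Lemma inG2_1 g : inG2 g -> g oct1 = oct1.
Proof.
move=> gG; rewrite -[LHS]oct_mul1r -{2}(inG2_VK gG oct1) -inG2_mulg //.
by rewrite oct_mul1l inG2_VK.
Qed.

(** Off the scalars, x and 1 are independent, so the quadratic equation of x determines its trace
    and norm. This is why algebra automorphisms are isometries. *)
Lemma scalar_tr_norm x (s t : K) :
  oct_mul x x = s *: x - t *: oct1 -> oct_tr x = s /\ oct_norm x = t \/
  exists k, x = k *: oct1.
Proof.
rewrite oct_sqr => E.
have {}E : (oct_tr x - s) *: x = (oct_norm x - t) *: oct1.
  rewrite !scalerBl; move/(canRL (subrK _)): E => ->.
  by rewrite addrAC [_ - _ - _]addrAC subrr sub0r addrC.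
have [s0|s0] := eqVneq (oct_tr x - s) 0; last first.
  right; exists ((oct_tr x - s)^-1 * (oct_norm x - t)).
  by rewrite -scalerA -E scalerA mulVf // scale1r.
left; split; first by apply/eqP; rewrite -subr_eq0 s0.
have := E; rewrite s0 scale0r => /esym/eqP.
by rewrite scaler_eq0 (negPf oct1_neq0) orbF subr_eq0 => /eqP.
Qed.

Lemma inG2_tr_norm g x : inG2 g ->
  oct_tr (g x) = oct_tr x /\ oct_norm (g x) = oct_norm x.
Proof.
move=> gG; have : oct_mul (g x) (g x) = oct_tr x *: g x - oct_norm x *: oct1.
  by rewrite -inG2_mulg // oct_sqr linearB !linearZ /= inG2_1.
case/scalar_tr_norm => // -[k gx].
suff -> : x = k *: oct1 by rewrite linearZ /= inG2_1.
by rewrite -(inG2_K gG x) gx linearZ /= -[X in g^-1%VF X](inG2_1 gG) inG2_K.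
Qed.

Lemma inG2_polar g x y : inG2 g -> oct_polar (g x) (g y) = oct_polar x y.
Proof.
by move=> gG; rewrite /oct_polar -linearD /= !(proj2 (inG2_tr_norm _ gG)).
Qed.

Lemma inG2_null_pair g u v : inG2 g -> null_pair u v -> null_pair (g u) (g v).
Proof.
move=> gG [tu tv uv uvf]; split.
- by rewrite (proj1 (inG2_tr_norm _ gG)).
- by rewrite (proj1 (inG2_tr_norm _ gG)).
- by rewrite -inG2_mulg // uv linear0.
apply/free2P => a b; rewrite -!linearZ -linearD /= => /(congr1 g^-1%VF).
by rewrite inG2_K // linear0; apply/free2P.
Qed.

Lemma null_pair0 : null_pair (oct_u0 : O) oct_v0.
Proof.
split; rewrite /oct_u0 /oct_v0.
- ocring.
- ocring.
- ocring.
- apply/free2P => a b; ocsimp => /oc_inj[[_ a0 _ _] [_ b0 _ _]].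
  by move: a0 b0; rewrite !mulr0 !mulr1 addr0 add0r.
Qed.

(** The element of so(O) attached to the bivector of u and v; being alternating in (u, v), it
    depends only on the plane, up to a scalar. *)
Definition null_der u v x : O := oct_polar v x *: u - oct_polar u x *: v.

Lemma null_der_linear u v : linear (null_der u v).
Proof.
move=> k x y; rewrite /null_der !oct_polarDr !oct_polarZr.
rewrite (scalerDl u) (scalerDl v) -!(scalerA k) scalerBr opprD.
exact: addrACA.
Qed.

HB.instance Definition _ u v :=
  GRing.isLinear.Build K O O *:%R (null_der u v) (null_der_linear u v).

Definition null_derivation u v : 'End(O) := linfun (null_der u v).

Lemma null_derivationE u v x :
  null_derivation u v x = oct_polar v x *: u - oct_polar u x *: v.
Proof. by rewrite lfunE. Qed.

Lemma Ad_null_derivation g u v : inG2 g ->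
  Ad g (null_derivation u v) = null_derivation (g u) (g v).
Proof.
move=> gG; apply/lfunP => x; rewrite !comp_lfunE !null_derivationE.
by rewrite linearB !linearZ /= -[x in RHS](inG2_VK gG) !inG2_polar.
Qed.

(** On the imaginary octonions a long root vector has Jordan type (2,2,1,1,1), a short one (3,2,2);
    the square-zero condition selects the former by quadratic equations. *)
Definition long_root_line (L : {vspace 'End(O)}) : Prop :=
  exists D, [/\ D != 0, in_g2 D, (D \o D)%VF = 0 & L = <[D]>%VS].

Lemma null_derivation0_g2 : in_g2 (null_derivation (oct_u0 : O) oct_v0).
Proof.
move=> x y; rewrite !null_derivationE /oct_u0 /oct_v0.
case: (octP x) (octP y) => ????????[????????]; ocring.
Qed.

(** The value at the vector of [null_pair_dual] is v, hence nonzero. The Leibniz rule is a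
    coordinate check at the reference pair, carried over by conjugation. The square vanishes since u
    and v are isotropic and orthogonal. *)
Lemma null_derivation_line u v : null_pair u v ->
  long_root_line <[null_derivation u v]>.
Proof.
move=> uv; exists (null_derivation u v).
have [nu nv Puv _] := null_pair_norm uv.
have [_ _ _ uv_free] := uv.
have [w [_ _ uw vw]] := null_pair_dual uv.
split=> //.
- apply/eqP => D0; have := null_derivationE u v w.
  rewrite D0 lfunE /= uw vw scale0r sub0r scaleN1r opprK => v0.
  have : v != 0 by apply: (free_not0 uv_free); rewrite !inE eqxx orbT.
  by rewrite -v0 eqxx.
- have [g [gG gu gv]] := null_pair_transitive uv.
  move=> x y; rewrite -gu -gv -Ad_null_derivation // /Ad !comp_lfunE.
  have gV z t : (g^-1)%VF (oct_mul z t) = oct_mul (g^-1%VF z) (g^-1%VF t).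
    by apply: (can_inj (inG2_K gG)); rewrite inG2_mulg // !inG2_VK.
  by rewrite gV null_derivation0_g2 linearD /= !inG2_mulg // !inG2_VK.
- apply/lfunP => x; rewrite comp_lfunE !null_derivationE !lfunE /=.
  rewrite !oct_polarDr !oct_polarNr !oct_polarZr !oct_polarxx nu nv.
  by rewrite (oct_polarC v u) Puv !mul0rn !mulr0 !oppr0 !addr0 !scale0r subr0.
Qed.

Section Derivation.
Variable D : 'End(O).
Hypothesis D_der : in_g2 D.

Lemma der1 : D oct1 = 0.
Proof.
have := D_der oct1 oct1; rewrite !oct_mul1l oct_mul1r => /eqP.
by rewrite -subr_eq0 opprD addrA subrr sub0r oppr_eq0 => /eqP.
Qed.

(** Applying D to x x = tr(x) x - N(x) gives tr(D x) x = P(x, D x). If tr(D x) were nonzero, x would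
    be a scalar, and then D x = 0. *)
Lemma der_imag_skew x : oct_tr (D x) = 0 /\ oct_polar x (D x) = 0.
Proof.
have E : oct_tr (D x) *: x = oct_polar x (D x) *: oct1.
  have := D_der x x; rewrite oct_sqr linearB !linearZ /=.
  rewrite der1 oppr0 scaler0 addr0 addrC oct_mulC -addrA -[LHS]addr0 => /addrI/esym/eqP.
  by rewrite subr_eq0 => /eqP.
have [t0|t0] := eqVneq (oct_tr (D x)) 0.
  split=> //; have := E; rewrite t0 scale0r => /esym/eqP.
  by rewrite scaler_eq0 (negPf oct1_neq0) orbF => /eqP.
have /eqP[] := t0; have -> : x = ((oct_tr (D x))^-1 * oct_polar x (D x)) *: oct1.
  by rewrite -scalerA -E scalerA mulVf // scale1r.
by rewrite linearZ /= der1 scaler0 /oct_tr !mxE addr0.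
Qed.

Lemma der_skew x y : oct_polar x (D y) = - oct_polar (D x) y.
Proof.
have := proj2 (der_imag_skew (x + y)).
rewrite linearD /= oct_polarDl !oct_polarDr !(proj2 (der_imag_skew _)).
by rewrite add0r addr0 (oct_polarC y) => /eqP; rewrite addr_eq0 => /eqP.
Qed.

Hypothesis D_sqr0 : (D \o D)%VF = 0.

(** By Leibniz, D (D (x y)) is twice D x times D y. *)
Lemma der_sqr0_mul x y : oct_mul (D x) (D y) = 0.
Proof.
have DD z : D (D z) = 0 by rewrite -comp_lfunE D_sqr0 lfunE.
have := congr1 D (D_der x y); rewrite DD linearD /= !D_der !DD.
rewrite oct_mul0l oct_mul0r addr0 add0r -mulr2n -scaler_nat => /esym/eqP.
by rewrite scaler_eq0 pnatr_eq0 => /eqP.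
Qed.

(** Take D a nonzero and b with P(D a, b) nonzero. By skewness P(D b, a) is nonzero while P(D a, a)
    = P(D b, b) = 0, so pairing with b and a shows independence. *)
Lemma der_sqr0_null_pair : D != 0 -> exists a b, null_pair (D a) (D b).
Proof.
have [/forallP D0|/forallPn[i Di] _] :=
  boolP [forall i, D (vbasis {:O})`_(i : 'I_(\dim {:O})) == 0].
  case/eqP; apply/lfunP => x; rewrite lfunE (coord_vbasis (memvf x)) linear_sum.
  by apply: big1 => i _; rewrite linearZ /= (eqP (D0 i)) scaler0.
set a := _`_i in Di; have [b ab] := oct_nondegenerate Di.
exists a, b; split; rewrite ?der_sqr0_mul ?(proj1 (der_imag_skew _)) //.
apply/free2P => s t st0.
have Daa : oct_polar (D a) a = 0 by rewrite oct_polarC (proj2 (der_imag_skew _)).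
have Dbb : oct_polar (D b) b = 0 by rewrite oct_polarC (proj2 (der_imag_skew _)).
split; apply/eqP.
  have /eqP := congr1 (oct_polar^~ b) st0; rewrite oct_polarDl !oct_polarZl Dbb.
  by rewrite mulr0 addr0 oct_polar0l mulf_eq0 (negPf ab) orbF.
have /eqP := congr1 (oct_polar^~ a) st0; rewrite oct_polarDl !oct_polarZl Daa.
rewrite mulr0 add0r oct_polar0l mulf_eq0 oct_polarC der_skew oppr_eq0 (negPf ab).
by rewrite orbF.
Qed.

End Derivation.

(* The image of [D] consists of trace-free octonions annihilated by [oct_u0] and
   [oct_v0] on the left, hence is the plane they span; skew-symmetry then leaves
   one parameter. *)
Lemma der_sqr0_null_derivation0 D : in_g2 D -> (D \o D)%VF = 0 ->
  (exists a, D a = oct_u0) -> (exists b, D b = oct_v0) ->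
  exists k, D = k *: null_derivation oct_u0 oct_v0.
Proof.
move=> D_der D_sqr0 [a Da] [b Db].
have DE x : D x = (D x).1 0 1 *: oct_u0 + (D x).2 0 1 *: oct_v0.
  have := der_sqr0_mul D_der D_sqr0 a x; rewrite Da.
  have := der_sqr0_mul D_der D_sqr0 b x; rewrite Db.
  have := proj1 (der_imag_skew D_der x).
  case: (octP (D x)) => p q r s p' q' r' s'; rewrite /oct_u0 /oct_v0 oct_trE !ocM.
  rewrite oc0 => ps0 /oc_inj[[e1 e2 e3 e4] [e5 e6 e7 e8]].
  move=> /oc_inj[[f1 f2 f3 f4] [f5 f6 f7 f8]].
  have r0 : r = 0 by rewrite -f1; ring.
  have s0 : s = 0 by rewrite -f2; ring.
  have p'0 : p' = 0 by rewrite -f6; ring.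
  have r'0 : r' = 0 by rewrite -f8; ring.
  have s'0 : s' = 0 by apply: oppr_inj; rewrite oppr0 -e2; ring.
  have p0 : p = 0 by rewrite -ps0 s0 addr0.
  by rewrite !mxE /= !ocZ ocD r0 s0 p'0 r'0 s'0 p0; congr oc; ring.
(* Dual to [oct_u0] and [oct_v0] for P. Skewness against y and z expresses both coefficients of D x
   through the single scalar f z = - k y. *)
pose y : O := oc 0 0 (-1) 0 0 0 0 0; pose z : O := oc 0 0 0 0 0 0 (-1) 0.
have uP x : oct_polar x oct_u0 = - x.1 1 0.
  by case: (octP x) => *; rewrite /oct_u0 oct_polarE /oc !mxE /=; ring.
have vP x : oct_polar x oct_v0 = - x.2 1 0.
  by case: (octP x) => *; rewrite /oct_v0 oct_polarE /oc !mxE /=; ring.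
pose f x := (D x).1 0 1; pose k x := (D x).2 0 1.
have rel x t : f t * oct_polar x oct_u0 + k t * oct_polar x oct_v0 =
    - (f x * oct_polar t oct_u0 + k x * oct_polar t oct_v0).
  have := der_skew D_der x t; rewrite (oct_polarC _ t) {1}(DE t) {1}(DE x).
  by rewrite !oct_polarDr !oct_polarZr.
have [yu yv zu zv] : [/\ oct_polar y oct_u0 = 1, oct_polar y oct_v0 = 0,
    oct_polar z oct_u0 = 0 & oct_polar z oct_v0 = 1].
  by rewrite !uP !vP !mxE /= opprK oppr0.
have self (c : K) : c = - c -> c = 0.
  by move/eqP; rewrite -addr_eq0 -mulr2n mulrn_eq0 => /eqP.
have fy : f y = 0.
  by apply: self; have := rel y y; rewrite yu yv !mulr0 !addr0 !mulr1.
have kz : k z = 0.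
  by apply: self; have := rel z z; rewrite zu zv !mulr0 !add0r !mulr1.
have fz : f z = - k y.
  by have := rel y z; rewrite yu yv zu zv !mulr0 !addr0 !add0r !mulr1.
exists (f z); apply/lfunP => x; rewrite DE lfunE /= null_derivationE -/(f x) -/(k x).
have := rel z x; rewrite zu zv mulr0 add0r mulr1 kz mul0r addr0 => ->.
have := rel y x; rewrite yu yv mulr0 addr0 mulr1 fy mul0r add0r => ->.
rewrite (oct_polarC oct_v0) (oct_polarC oct_u0) scalerBr !scalerA fz.
by rewrite !mulNr !scaleNr.
Qed.

Lemma long_root_lineP (L : {vspace 'End(O)}) : long_root_line L <->
  exists u v, null_pair u v /\ L = <[null_derivation u v]>%VS.
Proof.
split; last by case=> u [v [uv ->]]; apply: null_derivation_line.
case=> D [D0 D_der DD ->].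
have [a [b /null_pair_transitive[g [gG gu gv]]]] := der_sqr0_null_pair D_der DD D0.
(* Conjugation by g brings the reference pair into the image of the derivation. *)
have [||||k E] := @der_sqr0_null_derivation0 (g^-1 \o (D \o g))%VF.
- move=> x y; rewrite !comp_lfunE /= (inG2_mulg _ _ gG) D_der.
  apply: (can_inj (inG2_K gG)); rewrite (inG2_VK gG) [RHS]linearD /=.
  by rewrite !(inG2_mulg _ _ gG) !(inG2_VK gG).
- by apply/lfunP => x; rewrite !comp_lfunE inG2_VK // -(comp_lfunE D) DD !lfunE /= linear0.
- by exists (g^-1%VF a); rewrite !comp_lfunE inG2_VK // -gu inG2_K.
- by exists (g^-1%VF b); rewrite !comp_lfunE inG2_VK // -gv inG2_K.
exists (g oct_u0), (g oct_v0); split.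
  exact: inG2_null_pair null_pair0.
have DE : D = k *: null_derivation (g oct_u0) (g oct_v0).
  apply/lfunP => x; rewrite -Ad_null_derivation // lfunE /= !comp_lfunE.
  by rewrite -linearZ /= -scale_lfunE -E !comp_lfunE !(inG2_VK gG).
rewrite DE vlineZ //; apply: contraNneq D0 => k0.
by rewrite DE k0 scale0r.
Qed.


End AdjointOrbit.

(** * The adjoint variety is closed *)

Section LinearPolynomials.
Context {F : fieldType}.
Implicit Types (W : vectType F).

Lemma dim1_vline W (L : {vspace W}) :
  \dim L = 1%N -> exists2 w, w != 0 & L = <[w]>%VS.
Proof.
move=> L1; have L0 : L != 0%VS by rewrite -dimv_eq0 L1.
exists (vpick L); first by rewrite vpick0.
by apply/eqP; rewrite eq_sym eqEdim L1 dim_vline vpick0 L0 -memvE memv_pick.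
Qed.

Definition linear_poly W (f : W -> F) : poly_on W :=
  \sum_(i < \dim {:W}) f (vbasis {:W})`_i *: 'X_i.

Lemma linear_poly_homog W f : @linear_poly W f \is 1.-homog.
Proof.
by apply: rpred_sum => i _; apply: rpredZ; rewrite dhomogX; apply/eqP/mdeg1.
Qed.

Lemma linear_polyE W (f : {linear W -> F^o}) w : poly_eval (linear_poly f) w = f w.
Proof.
rewrite [in RHS](coord_vbasis (memvf w)) linear_sum /poly_eval /linear_poly raddf_sum.
by apply: eq_bigr => i _; rewrite linearZ /= mevalZ mevalXU mulrC.
Qed.

(** The equations are all homogeneous polynomials vanishing on X, so a proof of closedness only has
    to exhibit those it uses. *)
Lemma zariski_closedP W (X : {vspace W} -> Prop) :
  (forall L, X L -> \dim L = 1%N) ->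
  (forall w, w != 0 ->
    (forall p : poly_on W, (exists k : nat, p \is k.-homog) ->
      (forall L, X L -> forall x, x \in L -> poly_eval p x = 0) ->
      poly_eval p w = 0) ->
    X <[w]>%VS) ->
  zariski_closed X.
Proof.
move=> Xdim Xzero.
exists (fun p => (exists k : nat, p \is k.-homog) /\
   forall L, X L -> forall x, x \in L -> poly_eval p x = 0).
  by move=> p [].
move=> L; split=> [XL|[/dim1_vline[w w0 ->] zero]].
  by split=> [|p [_ pX]]; [apply: Xdim | apply: pX].
by apply: Xzero => // p ph pX; apply: zero (memv_line w).
Qed.

End LinearPolynomials.

Section AdjointVariety.
Context {K : numFieldType}.
Local Notation O := (@octonion K).
Local Notation E := 'End(O).
Implicit Types (D : E) (x y : O).

Definition oct_coord (i : 'I_(\dim {:O})) x : K := coord (vbasis {:O}) i x.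

Lemma oct_coord0 x : (forall i, oct_coord i x = 0) -> x = 0.
Proof.
move=> x0; rewrite (coord_vbasis (memvf x)); apply: big1 => i _.
by rewrite -/(oct_coord i x) x0 scale0r.
Qed.

Lemma oct_coordP i k x y : oct_coord i (k *: x + y) = k * oct_coord i x + oct_coord i y.
Proof. by rewrite /oct_coord linearP. Qed.

Lemma long_root_line_closed : zariski_closed (@long_root_line K).
Proof.
apply: zariski_closedP => [L [D [D0 _ _ ->]]|D D0 zero].
  by rewrite dim_vline D0.
exists D; split=> //.
- move=> x y; apply/eqP; rewrite -subr_eq0; apply/eqP; apply: oct_coord0 => i.
  pose f (H : E) : K^o :=
    oct_coord i (H (oct_mul x y) - (oct_mul (H x) y + oct_mul x (H y))).
  have f_lin : linear f.
    move=> k H H'; rewrite /f !lfunE /= !lfunE /= !oct_mulDl !oct_mulDr.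
    rewrite !oct_mulZl !oct_mulZr.
    rewrite -oct_coordP; congr oct_coord.
    by rewrite scalerBr scalerDr [X in _ - X]addrACA opprD addrACA.
  pose fL : {linear E -> K^o} := HB.pack f (GRing.isLinear.Build _ _ _ _ f f_lin).
  rewrite -[LHS]/(fL D) -linear_polyE; apply: zero.
    by exists 1%N; apply: linear_poly_homog.
  move=> _ [H [H0 H_der _ ->]] _ /vlineP[k ->]; rewrite linear_polyE linearZ /= /f.
  by rewrite H_der subrr /oct_coord linear0 scaler0.
- apply/lfunP => x; rewrite lfunE /= lfunE /=; apply: oct_coord0 => i.
  pose b : (\dim {:O}).-tuple O := vbasis {:O}.
  pose f j (H : E) : K^o := oct_coord j (H x).
  pose h j (H : E) : K^o := oct_coord i (H b`_j).
  have f_lin j : linear (f j).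
    by move=> k H H'; rewrite /f !lfunE /= !lfunE /= oct_coordP.
  have h_lin j : linear (h j).
    by move=> k H H'; rewrite /h !lfunE /= !lfunE /= oct_coordP.
  pose fL j : {linear E -> K^o} :=
    HB.pack (f j) (GRing.isLinear.Build _ _ _ _ (f j) (f_lin j)).
  pose hL (j : 'I_(\dim {:O})) : {linear E -> K^o} :=
    HB.pack (h j) (GRing.isLinear.Build _ _ _ _ (h j) (h_lin j)).
  (* A coordinate of H (H x) as a quadratic form in H: expand the inner H x in the basis [b]. *)
  pose p : poly_on E := \sum_j linear_poly (fL j) * linear_poly (hL j).
  have pE H : poly_eval p H = oct_coord i (H (H x)).
    rewrite [in RHS](coord_vbasis (memvf (H x))) linear_sum /oct_coord linear_sum.
    rewrite /poly_eval /p raddf_sum; apply: eq_bigr => j _.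
    transitivity (poly_eval (linear_poly (fL j)) H * poly_eval (linear_poly (hL j)) H).
      exact: mevalM.
    by rewrite !linear_polyE /= !linearZ.
  rewrite -pE; apply: zero.
    exists 2%N; apply: rpred_sum => j _.
    by apply: (@dhomogM _ _ _ 1 _ 1); apply: linear_poly_homog.
  move=> _ [H [H0 _ HH ->]] _ /vlineP[k ->]; rewrite pE !scale_lfunE linearZ /=.
  by rewrite -comp_lfunE HH zero_lfunE !scaler0 /oct_coord linear0.
Qed.

Lemma long_root_line_adjoint : is_adjoint_variety (@long_root_line K).
Proof.
split; first exact: long_root_line_closed.
have [D [D0 D_der DD DL]] := null_derivation_line (@null_pair0 K).
exists (null_derivation oct_u0 oct_v0); split.
- exact: null_derivation0_g2.
- have := dim_vline (null_derivation oct_u0 oct_v0 : E).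
  by rewrite DL dim_vline D0; case: eqP.
move=> L; split=> [/long_root_lineP[u [v [uv ->]]]|[g gG ->]].
  have [g [gG <- <-]] := null_pair_transitive uv.
  by exists g => //; rewrite Ad_null_derivation.
rewrite Ad_null_derivation //; apply: null_derivation_line.
exact: inG2_null_pair null_pair0.
Qed.

End AdjointVariety.

(** * Isomorphisms induced by injective linear maps *)

Section LinearIsomorphism.
Context {F : fieldType}.
Variables (W W' : vectType F).
Implicit Types (X : {vspace W} -> Prop) (Y : {vspace W'} -> Prop).

Lemma regular_map_lfun X Y (T : 'Hom(W, W')) :
  (forall L, X L -> Y (T @: L)%VS) -> (forall w, X <[w]>%VS -> T w != 0) ->
  regular_map X Y (fun L => (T @: L)%VS).
Proof.
move=> TXY T0; split=> // w Xw.
pose f i (x : W) : F^o := coord (vbasis {:W'}) i (T x).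
have f_lin i : linear (f i) by move=> k x y; rewrite /f !linearP.
pose fL i : {linear W -> F^o} := HB.pack (f i) (GRing.isLinear.Build _ _ _ _ (f i) (f_lin i)).
have PE x : poly_map_eval (fun i => linear_poly (fL i)) x = T x.
  rewrite [RHS](coord_vbasis (memvf _)).
  by apply: eq_bigr => i _; rewrite linear_polyE.
exists 1%N, (fun i => linear_poly (fL i)); split.
- by move=> i; apply: linear_poly_homog.
- by rewrite PE T0.
- by move=> x Xx _; rewrite PE limg_line.
Qed.

End LinearIsomorphism.

(** Both directions are given by linear forms: T^-1 is a linear map on all of W' and inverts T on
    its image, which contains every line of Y. *)
Lemma isomorphic_lfun (F : fieldType) (W W' : vectType F) (T : 'Hom(W, W'))
    (X : {vspace W} -> Prop) (Y : {vspace W'} -> Prop) :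
  lker T = 0%VS -> (forall L, X L -> \dim L = 1%N) ->
  (forall M, Y M <-> exists2 L, X L & M = (T @: L)%VS) ->
  isomorphic_varieties X Y.
Proof.
move=> /eqP Tinj Xdim XY.
have TK L : (T^-1 @: (T @: L))%VS = L by rewrite -limg_comp lker0_compVf // lim1g.
have neq0 w : X <[w]>%VS -> w != 0.
  by move/Xdim; rewrite dim_vline; case: eqP.
exists (fun L => (T @: L)%VS), (fun M => (T^-1 @: M)%VS); split.
- apply: regular_map_lfun => [L XL|w /neq0]; first by apply/XY; exists L.
  by rewrite -!memv_ker (eqP Tinj) memv0.
- apply: regular_map_lfun => [M /XY[L XL ->]|w /XY[L XL Lw]]; first by rewrite TK.
  rewrite -(TK L) -Lw limg_line in XL; exact: neq0 XL.
- by move=> L XL; rewrite TK.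
- by move=> M /XY[L XL ->]; rewrite TK.
Qed.

(** * The spin representation as the octonions *)

Section Polar.
Context {K : fieldType}.
Variable B : 'M[K]_7.
Implicit Types (u v w : 'cV[K]_7).

Lemma polarDl u v w : polar B (u + v) w = polar B u w + polar B v w.
Proof. by rewrite /polar linearD /= !mulmxDl mxE. Qed.
Lemma polarDr u v w : polar B w (u + v) = polar B w u + polar B w v.
Proof. by rewrite /polar !mulmxDr mxE. Qed.
Lemma polarZl k u v : polar B (k *: u) v = k * polar B u v.
Proof. by rewrite /polar linearZ /= -!scalemxAl mxE. Qed.
Lemma polarZr k u v : polar B u (k *: v) = k * polar B u v.
Proof. by rewrite /polar -!scalemxAr mxE. Qed.
Lemma polar_sumr (I : finType) (f : I -> 'cV[K]_7) u :
  polar B u (\sum_i f i) = \sum_i polar B u (f i).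
Proof. by rewrite /polar mulmx_sumr summxE. Qed.

Hypothesis B_nondegenerate : nondegenerate_form B.

Lemma polarC u v : polar B u v = polar B v u.
Proof.
rewrite /polar; suff -> : v^T *m B *m u = (u^T *m B *m v)^T by rewrite [RHS]mxE.
by rewrite !trmx_mul trmxK (proj1 B_nondegenerate) mulmxA.
Qed.

Lemma polar_nondegenerate u : u != 0 -> exists v, polar B u v != 0.
Proof.
move=> u0; have : u^T *m B != 0.
  apply: contraNneq u0 => uB0; have [_ Bu] := B_nondegenerate.
  by rewrite -[u]trmxK -(mulmxK Bu u^T) uB0 mul0mx trmx0.
case/rV0Pn => j uBj; exists (delta_mx j 0).
by rewrite /polar -colE mxE.
Qed.

End Polar.

Section OrthonormalBasis.
Context {K : numClosedFieldType}.
Variable B : 'M[K]_7.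
Hypothesis B_nondegenerate : nondegenerate_form B.

Lemma exists_orthogonal n (f : 'I_n -> 'cV[K]_7) : (n < 7)%N ->
  exists2 w, w != 0 & forall i, polar B (f i) w = 0.
Proof.
move=> n7; pose A := \matrix_(i < n, j < 7) ((f i)^T *m B) 0 j.
have : kermx A^T != 0.
  by rewrite -mxrank_eq0 mxrank_ker -lt0n subn_gt0 (leq_ltn_trans (rank_leq_col _)).
move/rowV0Pn => [w /sub_kermxP wA w0]; exists w^T; first by rewrite trmx_eq0.
move=> i; have := congr1 (fun M : 'rV_n => M 0 i) wA; rewrite !mxE => <-.
by rewrite /polar !mxE; apply: eq_bigr => j _; rewrite !mxE mulrC.
Qed.

(** With value -1 instead of 1 the Clifford generators square to -1, like the imaginary units of
    O. *)
Lemma exists_anti_orthonormal n : (n <= 7)%N -> exists f : 'I_n -> 'cV[K]_7,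
  forall i j, polar B (f i) (f j) = - (i == j)%:R.
Proof.
elim: n => [|n IHn] n7; first by exists (fun _ => 0) => -[].
have [f fP] := IHn (ltnW n7).
have [w w0 wf] := exists_orthogonal f n7.
have [x0 wx0] := polar_nondegenerate B_nondegenerate w0.
(* Orthogonal projection away from the f i; the sign is + because they have square -1. *)
pose x := x0 + \sum_i polar B x0 (f i) *: f i.
have xf i : polar B (f i) x = 0.
  rewrite polarDr polar_sumr (bigD1 i) //= big1 ?addr0.
    by rewrite polarZr fP eqxx mulrN1 (polarC B_nondegenerate x0) subrr.
  by move=> j ij; rewrite polarZr fP eq_sym (negPf ij) oppr0 mulr0.
have wx : polar B w x != 0.
  rewrite polarDr polar_sumr big1 ?addr0 // => j _.
  by rewrite polarZr (polarC B_nondegenerate w) wf mulr0.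
clearbody x.
(* If w and x are both isotropic, w + x is not, as w and x are not orthogonal. *)
have [y yy yf] : exists2 y, polar B y y != 0 & forall i, polar B (f i) y = 0.
  have [ww|] := eqVneq (polar B w w) 0; last by exists w.
  have [xx|] := eqVneq (polar B x x) 0; last by exists x.
  exists (w + x); last by move=> i; rewrite polarDr wf xf addr0.
  rewrite polarDl !polarDr ww xx add0r addr0 (polarC B_nondegenerate x).
  by rewrite -mulr2n mulrn_eq0.
pose z := sqrtC (- (polar B y y)^-1) *: y.
have zz : polar B z z = -1.
  by rewrite polarZl polarZr mulrA -expr2 sqrtCK mulNr mulVf.
have zf i : polar B (f i) z = 0 by rewrite polarZr yf mulr0.
exists (fun i => oapp f z (unlift ord_max i)) => i j.
case: (unliftP ord_max i) => [i'|] ->; case: (unliftP ord_max j) => [j'|] -> /=.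
- by rewrite fP (inj_eq (lift_inj (h:=_))).
- by rewrite zf eq_sym (negPf (neq_lift _ _)) oppr0.
- by rewrite (polarC B_nondegenerate z) zf (negPf (neq_lift _ _)) oppr0.
- by rewrite zz eqxx.
Qed.

End OrthonormalBasis.

(* Multiplication table of [oct_basis] below, with the basis numbered so that the
   index of a product is the bitwise sum of the indices. *)
Definition fano_index (a b : nat) : nat := nth 0%N (nth [::]
  [:: [:: 0; 1; 2; 3; 4; 5; 6; 7]; [:: 1; 0; 3; 2; 5; 4; 7; 6];
      [:: 2; 3; 0; 1; 6; 7; 4; 5]; [:: 3; 2; 1; 0; 7; 6; 5; 4];
      [:: 4; 5; 6; 7; 0; 1; 2; 3]; [:: 5; 4; 7; 6; 1; 0; 3; 2];
      [:: 6; 7; 4; 5; 2; 3; 0; 1]; [:: 7; 6; 5; 4; 3; 2; 1; 0]] a) b.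

Definition fano_sign (a b : nat) : nat := nth 0%N (nth [::]
  [:: [:: 0; 0; 0; 0; 0; 0; 0; 0]; [:: 0; 1; 0; 1; 0; 1; 1; 0];
      [:: 0; 1; 1; 0; 0; 0; 1; 1]; [:: 0; 0; 1; 1; 0; 1; 0; 1];
      [:: 0; 1; 1; 1; 1; 0; 0; 0]; [:: 0; 0; 1; 0; 1; 1; 1; 0];
      [:: 0; 0; 0; 1; 1; 0; 1; 1]; [:: 0; 1; 0; 0; 1; 1; 0; 1]] a) b.

Section OctonionBasis.
Context {K : numClosedFieldType}.
Local Notation O := (@octonion K).
Local Notation i := ('i : K).

(** Elements 0 to 3 are a quaternion basis of the 2 x 2 matrices, and element 4 + k is element k
    times l = (0, 1). The square root of -1 makes all norms equal to 1. *)
Definition oct_basis (k : nat) : O :=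
  match k with
  | 0 => oc 1 0 0 1 0 0 0 0
  | 1 => oc i 0 0 (- i) 0 0 0 0
  | 2 => oc 0 1 (-1) 0 0 0 0 0
  | 3 => oc 0 i i 0 0 0 0 0
  | 4 => oc 0 0 0 0 1 0 0 1
  | 5 => oc 0 0 0 0 i 0 0 (- i)
  | 6 => oc 0 0 0 0 0 1 (-1) 0
  | _ => oc 0 0 0 0 0 i i 0
  end.

Let ii : i ^+ 2 = -1. Proof. exact: sqrCi. Qed.

Lemma oct_basisM a b : (a < 8)%N -> (b < 8)%N ->
  oct_mul (oct_basis a) (oct_basis b) =
  (-1) ^+ fano_sign a b *: oct_basis (fano_index a b).
Proof.
do 8?[case: a => [|a] //] => _; do 8?[case: b => [|b] //] => _;
  by rewrite /oct_basis /fano_sign /fano_index /= ocM ocZ; congr oc; ring: ii.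
Qed.

Lemma oct_basis_polar a b : (a < 8)%N -> (b < 8)%N ->
  oct_polar (oct_basis a) (oct_basis b) = (a == b)%:R *+ 2.
Proof.
do 8?[case: a => [|a] //] => _; do 8?[case: b => [|b] //] => _;
  by rewrite /oct_basis /= oct_polarE; ring: ii.
Qed.

Lemma oct_basis_expand x :
  x = \sum_(k < 8) (oct_polar x (oct_basis k) / 2) *: oct_basis k.
Proof.
rewrite !big_ord_recr big_ord0 /= add0r.
case: (octP x) => ????????; rewrite !oct_polarE !ocZ !ocD.
by congr oc; field: ii.
Qed.

(* The unit spans the common eigenspace of the operators [x |-> a (b (c x))], for
   the seven quaternionic triples [a b = c]. *)
Lemma oct_tr_projection x :
  oct_tr x *+ 4 *: oct1 = x - \sum_(t <- [:: (1, 2, 3); (1, 4, 5); (2, 4, 6); (3, 4, 7);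
    (1, 7, 6); (2, 5, 7); (3, 6, 5)]%N)
    oct_mul (oct_basis t.1.1) (oct_mul (oct_basis t.1.2) (oct_mul (oct_basis t.2) x)).
Proof.
rewrite !big_cons big_nil /oct_basis /=.
case: (octP x) => ????????; ocsimp.
by congr oc; ring: ii.
Qed.

End OctonionBasis.

Arguments oct_basis : simpl never.

(** * Clifford generators and the Fano plane *)

Section FanoRelations.
Context {K : numFieldType} {n : nat}.
Local Notation M := 'M[K]_n.+1.
Implicit Types (A C : M) (d : 'cV[K]_n.+1).

Definition sign_comm (b : bool) A C := A * C = (-1) ^+ b * (C * A).

Lemma sign_commMr b c A C C' : sign_comm b A C -> sign_comm c A C' ->
  sign_comm (b (+) c) A (C * C').
Proof.
rewrite /sign_comm mulrA; case: b; case: c => /=;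
  rewrite !(expr0, expr1, mul1r, mulN1r) => -> hAC';
  by rewrite -?mulrA ?mulNr -?mulrA hAC' ?mulrN ?opprK ?mulrA.
Qed.

Lemma sign_commMl b c A A' C : sign_comm b A C -> sign_comm c A' C ->
  sign_comm (b (+) c) (A * A') C.
Proof.
rewrite /sign_comm -mulrA; case: b; case: c => /=;
  rewrite !(expr0, expr1, mul1r, mulN1r) => hAC ->;
  by rewrite ?mulrN !mulrA hAC ?mulNr ?opprK.
Qed.

(** Either d + A d is an eigenvector for 1, or it vanishes and d is one for -1. Operators commuting
    with A keep their eigenvalues on the new vector, so commuting involutions can be treated one
    after another. *)
Lemma involution_eigenvector A d : A * A = 1 -> d != 0 ->
  exists2 d' : 'cV[K]_n.+1, d' != 0 & (exists s : bool, A *m d' = (-1) ^+ s *: d') /\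
    forall C k, sign_comm false C A -> C *m d = k *: d -> C *m d' = k *: d'.
Proof.
move=> AA d0; have [dA|dA] := eqVneq (d + A *m d) 0.
  exists d => //; split=> //; exists true.
  by rewrite expr1 scaleN1r; apply/eqP; rewrite -addr_eq0 addrC dA.
exists (d + A *m d) => //; split=> [|C k].
  by exists false; rewrite expr0 scale1r mulmxDr mulmxA mulmxE AA mul1mx addrC.
rewrite /sign_comm expr0 mul1r => CA Cd.
by rewrite mulmxDr mulmxA mulmxE CA -mulmxE -mulmxA Cd -scalemxAr scalerDr.
Qed.

Variable G : nat -> M.
Hypothesis G_sqr : forall a, (0 < a < 8)%N -> G a * G a = -1.
Hypothesis G_comm : forall a b, (0 < a < 8)%N -> (0 < b < 8)%N ->
  sign_comm (a != b) (G a) (G b).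

(** [G c] commutes with [G a * G b], two signs cancelling; both factors square to -1. *)
Lemma triple_sqr a b c : (0 < a < 8)%N -> (0 < b < 8)%N -> (0 < c < 8)%N ->
  a != b -> b != c -> a != c -> (G a * G b * G c) * (G a * G b * G c) = 1.
Proof.
move=> a8 b8 c8 ab bc ac.
have c_ab : sign_comm false (G c) (G a * G b).
  have := sign_commMr (G_comm c8 a8) (G_comm c8 b8).
  by rewrite (eq_sym c) ac (eq_sym c) bc.
have := G_comm b8 a8; rewrite /sign_comm (eq_sym b) ab mulN1r => ba.
rewrite -[LHS]mulrA (mulrA (G c)) c_ab mul1r -!mulrA G_sqr // (mulrA (G b)) ba.
by rewrite !mulrN !mulNr !mulrN !mulr1 !mulrA G_sqr // mulN1r mulNr G_sqr // !opprK.
Qed.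

Definition fano_vector d k : 'cV[K]_n.+1 := if k is 0%N then d else G k *m d.

(** Required at [d] alone: for distinct a, b, c any other generator commutes with [G a * G b] but
    anticommutes with [G c]. *)
Definition fano_triple d a b c := G a *m (G b *m d) = G c *m d.

Lemma fano_triple_act d a b c :
  (0 < a < 8)%N -> (0 < b < 8)%N -> (0 < c < 8)%N ->
  a != b -> b != c -> a != c -> fano_triple d a b c ->
  [/\ G b *m (G c *m d) = G a *m d, G c *m (G a *m d) = G b *m d &
  [/\ G b *m (G a *m d) = - (G c *m d), G c *m (G b *m d) = - (G a *m d)
    & G a *m (G c *m d) = - (G b *m d)]].
Proof.
move=> a8 b8 c8 ab bc ac abc.
have sw x y : (0 < x < 8)%N -> (0 < y < 8)%N -> x != y -> forall z : 'cV_n.+1,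
    G x *m (G y *m z) = - (G y *m (G x *m z)).
  move=> x8 y8 xy z; rewrite !mulmxA !mulmxE (G_comm x8 y8) xy.
  by rewrite mulN1r mulNmx.
have sq x : (0 < x < 8)%N -> forall z : 'cV_n.+1, G x *m (G x *m z) = - z.
  by move=> x8 z; rewrite mulmxA mulmxE G_sqr // mulNmx mul1mx.
have ba : G b *m (G a *m d) = - (G c *m d) by rewrite sw 1?eq_sym // abc.
have ac' : G a *m (G c *m d) = - (G b *m d) by rewrite -abc sq.
have bc' : G b *m (G c *m d) = G a *m d.
  by rewrite -[G c *m d]opprK -ba mulmxN sq // opprK.
split=> //; first by rewrite sw 1?eq_sym // ac' opprK.
by split=> //; rewrite sw 1?eq_sym // bc'.
Qed.

(* Four triples of the Fano plane determine the remaining three. *)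
Lemma fano_act d a b : fano_triple d 1 2 3 -> fano_triple d 1 4 5 ->
  fano_triple d 2 4 6 -> fano_triple d 3 4 7 -> (0 < a < 8)%N -> (b < 8)%N ->
  G a *m fano_vector d b = (-1) ^+ fano_sign a b *: fano_vector d (fano_index a b).
Proof.
move=> t123 t145 t246 t347.
have sw x y (z : 'cV_n.+1) : (0 < x < 8)%N -> (0 < y < 8)%N -> x != y ->
    G x *m (G y *m z) = - (G y *m (G x *m z)).
  move=> x8 y8 xy; rewrite !mulmxA !mulmxE (G_comm x8 y8) xy.
  by rewrite mulN1r mulNmx.
have sq x (z : 'cV_n.+1) : (0 < x < 8)%N -> G x *m (G x *m z) = - z.
  by move=> x8; rewrite mulmxA mulmxE G_sqr // mulNmx mul1mx.
have t176 : fano_triple d 1 7 6.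
  rewrite /fano_triple -t347 (sw 3 4)%N // -t123 (sw 4 1)%N // opprK sq //.
  by rewrite (sw 4 2)%N // opprK.
have t257 : fano_triple d 2 5 7.
  rewrite /fano_triple -t145 -t347 (sw 3 4)%N // -t123 (sw 4 1)%N // opprK.
  by rewrite (sw 4 2)%N // mulmxN (sw 1 2)%N // opprK.
have t365 : fano_triple d 3 6 5.
  rewrite /fano_triple -t246 -t145 (sw 3 2)%N // (sw 3 4)%N // mulmxN opprK -t123.
  rewrite (sw 4 1)%N // (sw 4 2)%N // !mulmxN opprK (sw 2 1)%N // sq //.
  by rewrite mulmxN opprK.
have [//|//|//|//|//|//|a1 a2 [a3 a4 a5]] := fano_triple_act _ _ _ _ _ _ t123.
have [//|//|//|//|//|//|b1 b2 [b3 b4 b5]] := fano_triple_act _ _ _ _ _ _ t145.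
have [//|//|//|//|//|//|c1 c2 [c3 c4 c5]] := fano_triple_act _ _ _ _ _ _ t246.
have [//|//|//|//|//|//|d1 d2 [d3 d4 d5]] := fano_triple_act _ _ _ _ _ _ t347.
have [//|//|//|//|//|//|e1 e2 [e3 e4 e5]] := fano_triple_act _ _ _ _ _ _ t176.
have [//|//|//|//|//|//|f1 f2 [f3 f4 f5]] := fano_triple_act _ _ _ _ _ _ t257.
have [//|//|//|//|//|//|g1 g2 [g3 g4 g5]] := fano_triple_act _ _ _ _ _ _ t365.
by do 8?[case: a => [|a] //] => _; do 8?[case: b => [|b] //] => _;
  rewrite /fano_sign /fano_index /= ?expr0 ?scale1r ?expr1 ?scaleN1r // sq.
Qed.

(** Two lines of the Fano plane share exactly one point, so eight of the nine pairs of generators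
    anticommute and the triple products commute. The eigenvalues are uncontrolled, whence the signs
    [s]. *)
Lemma exists_fano_eigenvector d0 : d0 != 0 -> exists2 d : 'cV[K]_n.+1, d != 0 &
  exists s : 'I_4 -> bool,
  [/\ G 1 *m (G 2 *m d) = (-1) ^+ s 0 *: (G 3 *m d),
      G 1 *m (G 4 *m d) = (-1) ^+ s 1 *: (G 5 *m d),
      G 2 *m (G 4 *m d) = (-1) ^+ s 2 *: (G 6 *m d)
    & G 3 *m (G 4 *m d) = (-1) ^+ s 3 *: (G 7 *m d)].
Proof.
move=> d00.
have comm a b c a' b' c' :
    (0 < a < 8)%N -> (0 < b < 8)%N -> (0 < c < 8)%N ->
    (0 < a' < 8)%N -> (0 < b' < 8)%N -> (0 < c' < 8)%N ->
    ((a != a') (+) (a != b') (+) (a != c')) (+)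
    ((b != a') (+) (b != b') (+) (b != c')) (+)
    ((c != a') (+) (c != b') (+) (c != c')) = false ->
    sign_comm false (G a * G b * G c) (G a' * G b' * G c').
  move=> a8 b8 c8 a8' b8' c8' <-.
  by do ?apply: sign_commMl; do ?apply: sign_commMr; apply: G_comm.
pose T a b c := G a * G b * G c.
have inv a b c := @triple_sqr a b c.
have [d1 d1_neq0 [[s1 E1] _]] :=
  involution_eigenvector (inv 1 2 3 isT isT isT isT isT isT)%N d00.
have [d2 d2_neq0 [[s2 E2] k2]] :=
  involution_eigenvector (inv 1 4 5 isT isT isT isT isT isT)%N d1_neq0.
have [d3 d3_neq0 [[s3 E3] k3]] :=
  involution_eigenvector (inv 2 4 6 isT isT isT isT isT isT)%N d2_neq0.
have [d d_neq0 [[s4 E4] k4]] :=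
  involution_eigenvector (inv 3 4 7 isT isT isT isT isT isT)%N d3_neq0.
exists d => //.
have {}E1 : T 1 2 3 *m d = (-1) ^+ s1 *: d.
  by apply: k4; [exact: comm | apply: k3; [exact: comm | apply: k2; [exact: comm | ]]].
have {}E2 : T 1 4 5 *m d = (-1) ^+ s2 *: d.
  by apply: k4; [exact: comm | apply: k3; [exact: comm | ]].
have {}E3 : T 2 4 6 *m d = (-1) ^+ s3 *: d by apply: k4; [exact: comm | ].
(* Multiply by [G c], which commutes with [G a * G b]; its square -1 flips the sign. *)
have tr a b c (s : bool) : (0 < a < 8)%N -> (0 < b < 8)%N -> (0 < c < 8)%N ->
    a != b -> b != c -> a != c -> T a b c *m d = (-1) ^+ s *: d ->
    G a *m (G b *m d) = (-1) ^+ (~~ s) *: (G c *m d).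
  move=> a8 b8 c8 ab bc ac Ed.
  have := sign_commMr (G_comm c8 a8) (G_comm c8 b8).
  rewrite (eq_sym c) ac (eq_sym c) bc /sign_comm expr0 mul1r => c_ab.
  have := congr1 (mulmx (G c)) Ed.
  rewrite /T -c_ab mulmxA mulmxE mulrA G_sqr // mulN1r mulNmx -mulmxE -mulmxA.
  by rewrite -scalemxAr signrN scaleNr => <-; rewrite opprK.
exists (fun j => ~~ nth false [:: s1; s2; s3; s4] j).
by split; apply: tr.
Qed.

End FanoRelations.

Lemma fano_index_lt a b : (a < 8)%N -> (b < 8)%N -> (fano_index a b < 8)%N.
Proof.
by do 8?[case: a => [|a] //] => _; do 8?[case: b => [|b] //] => _.
Qed.

Section Sums.
Context {K : fieldType}.
Local Notation O := (@octonion K).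

Lemma oct_mul_sumr (I : finType) (f : I -> O) x :
  oct_mul x (\sum_i f i) = \sum_i oct_mul x (f i).
Proof. exact: (big_morph (oct_mul x) (oct_mulDr x) (oct_mul0r x)). Qed.

Lemma oct_mul_suml (I : finType) (f : I -> O) x :
  oct_mul (\sum_i f i) x = \sum_i oct_mul (f i) x.
Proof.
exact: (big_morph (oct_mul^~ x) (fun y z => oct_mulDl y z x) (oct_mul0l x)).
Qed.

End Sums.

(** * Octonionic frames of a Clifford module *)

Section CliffordFrame.
Context {K : numClosedFieldType}.
Variables (B : 'M[K]_7) (gam : {linear 'cV[K]_7 -> 'M[K]_8}).
Hypothesis B_nondegenerate : nondegenerate_form B.
Hypothesis gam_clifford : clifford_action B gam.
Local Notation O := (@octonion K).

(* [G] identifies the spin representation with the octonions in such a way that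
   [v] acts as left multiplication by the imaginary octonion [iota v]. *)
Definition clifford_frame (G : 'Hom(O, 'cV[K]_8)) (iota : 'Hom('cV[K]_7, O)) :=
  [/\ lker G = 0%VS, forall v, oct_tr (iota v) = 0
    & forall v x, G (oct_mul (iota v) x) = gam v *m G x].

Lemma clifford_anticomm u v : gam u *m gam v + gam v *m gam u = (polar B u v *+ 2)%:M.
Proof.
have := gam_clifford (u + v); rewrite linearD /= !mulmxDl !mulmxDr !gam_clifford.
rewrite polarDl !polarDr (polarC B_nondegenerate v u) => E.
apply/eqP; rewrite -subr_eq0; apply/eqP.
move: (gam u *m gam v) (gam v *m gam u) E => M N /matrixP E.
apply/matrixP => i j; have /eqP := E i j; rewrite -subr_eq0 !mxE => /eqP <-.
by case: (i == j); rewrite ?mulr1n ?mulr0n; ring.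
Qed.

Lemma exists_clifford_frame :
  exists (G : 'Hom(O, 'cV[K]_8)) (iota : 'Hom('cV[K]_7, O)), clifford_frame G iota.
Proof.
have [f fP] := exists_anti_orthonormal B_nondegenerate (leqnn 7).
pose f' a := f (inord a.-1).
have fP' a b : (0 < a < 8)%N -> (0 < b < 8)%N -> polar B (f' a) (f' b) = - (a == b)%:R.
  case: a b => [|a] [|b] //= a8 b8; rewrite fP; congr (- (_ : bool)%:R).
  by rewrite -val_eqE /= !inordK ?eqSS.
have fano_gam (e : nat -> 'cV[K]_7) :
    (forall a b, (0 < a < 8)%N -> (0 < b < 8)%N -> polar B (e a) (e b) = - (a == b)%:R) ->
    (forall a, (0 < a < 8)%N -> gam (e a) * gam (e a) = -1) /\
    (forall a b, (0 < a < 8)%N -> (0 < b < 8)%N ->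
       sign_comm (a != b) (gam (e a)) (gam (e b))).
  move=> eP; split=> [a a8|a b a8 b8].
    by rewrite -mulmxE gam_clifford eP // eqxx rmorphN rmorph1.
  rewrite /sign_comm; have [-> /=|ab /=] := eqVneq a b; first by rewrite mul1r.
  have := clifford_anticomm (e a) (e b); rewrite eP // (negPf ab) oppr0 mul0rn.
  rewrite -!mulmxE raddf0 => /eqP; rewrite addr_eq0 => /eqP ->.
  by rewrite expr1 mulmxE mulN1r.
have [G_sqr G_comm] := fano_gam f' fP'.
have [|d d0 [s [t123 t145 t246 t347]]] :=
  exists_fano_eigenvector G_sqr G_comm (d0 := delta_mx 0 0).
  by apply/eqP => /matrixP/(_ 0 0)/eqP; rewrite !mxE /= oner_eq0.
(* Generators 3, 5, 6, 7 absorb the four signs. The relation for 7 also involves generator 3,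
   already changed by [s 0]. *)
pose c a := nth false [:: false; false; false; s 0; false; s 1; s 2; s 0 (+) s 3] a.
pose e a := (-1) ^+ c a *: f' a.
have eP a b : (0 < a < 8)%N -> (0 < b < 8)%N -> polar B (e a) (e b) = - (a == b)%:R.
  move=> a8 b8; rewrite polarZl polarZr fP' //; have [->|] := eqVneq a b.
    by rewrite mulrA -signr_addb addbb expr0 mul1r.
  by rewrite oppr0 !mulr0.
have [eG_sqr eG_comm] := fano_gam e eP.
have ge a : gam (e a) = (-1) ^+ c a *: gam (f' a) by rewrite linearZ.
have act := @fano_act _ _ (fun a => gam (e a)) eG_sqr eG_comm d.
have {act} act a b : (0 < a < 8)%N -> (b < 8)%N ->
    gam (e a) *m fano_vector (fun a => gam (e a)) d b =
    (-1) ^+ fano_sign a b *: fano_vector (fun a => gam (e a)) d (fano_index a b).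
  apply: act; rewrite /fano_triple !ge /c /= ?expr0 ?scale1r -?scalemxAl //.
  by rewrite t347 scalerA signr_addb.
clear ge; clearbody e.
move: act; set z := fano_vector _ d => act.
pose g (x : O) : 'cV[K]_8 := \sum_(k < 8) (oct_polar x (oct_basis k) / 2) *: z k.
have g_lin : linear g.
  move=> k x y; rewrite /g scaler_sumr -big_split /=; apply: eq_bigr => j _.
  by rewrite oct_polarDl oct_polarZl mulrDl scalerDl scalerA mulrA.
have [G GE] := exists_lfun g_lin.
pose h v : O := \sum_(k < 7) (- polar B v (e k.+1)) *: oct_basis k.+1.
have h_lin : linear h.
  move=> k x y; rewrite /h scaler_sumr -big_split /=; apply: eq_bigr => j _.
  by rewrite polarDl polarZl opprD scalerDl -mulrN scalerA.
have [iota iotaE] := exists_lfun h_lin.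
have G_basis a : (a < 8)%N -> G (oct_basis a) = z a.
  move=> a8; rewrite GE /g (bigD1 (Ordinal a8)) //= oct_basis_polar // eqxx.
  rewrite divff ?pnatr_eq0 // scale1r big1 ?addr0 // => k ka.
  rewrite oct_basis_polar //; case: eqP => [ak|_]; last by rewrite mul0rn mul0r scale0r.
  by case/eqP: ka; apply: val_inj.
have G_mul a x : (0 < a < 8)%N -> G (oct_mul (oct_basis a) x) = gam (e a) *m G x.
  move=> a8; rewrite (oct_basis_expand x) oct_mul_sumr !linear_sum /=.
  apply: eq_bigr => k _; rewrite oct_mulZr !linearZ /=; congr (_ *: _).
  have a_lt8 : (a < 8)%N by case/andP: a8.
  rewrite G_basis // act // oct_basisM // linearZ /= G_basis // fano_index_lt //.
have ord7 (k : 'I_7) : (0 < k.+1 < 8)%N by case: k.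
have gam_expand v : gam v = \sum_(k < 7) (- polar B v (e k.+1)) *: gam (e k.+1).
  pose E := \matrix_(i < 7, j < 7) e j.+1 i 0.
  have colE (k : 'I_7) : col k E = e k.+1.
    by apply/matrixP => i j; rewrite !mxE (ord1 j).
  (* The Gram relations give a left inverse of the square matrix E; used as a right inverse, it
     expands every vector in the e k. *)
  have /mulmx1C EE : - (E^T *m B) *m E = 1%:M.
    apply/matrixP => i j; rewrite mulNmx mxE.
    have -> : (E^T *m B *m E) i j = polar B (e i.+1) (e j.+1).
      rewrite /polar -!colE tr_col -!row_mul [LHS]mxE 2![RHS]mxE.
      by apply: eq_bigr => k _; congr (_ * _); rewrite [RHS]mxE.
    by rewrite eP; [rewrite opprK mxE eqSS | exact: ord7 | exact: ord7].
  have vE : v = \sum_(k < 7) (- polar B v (e k.+1)) *: e k.+1.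
    apply/matrixP => i j; rewrite (ord1 j) -[v in LHS]mul1mx -EE -mulmxA mxE summxE.
    apply: eq_bigr => k _; rewrite [RHS]mxE mulrC [E i k]mxE; congr (_ * _).
    rewrite mulNmx mxE polarC // /polar -colE tr_col -!row_mul; congr (- _).
    by rewrite [RHS]mxE.
  by rewrite [in LHS]vE linear_sum; apply: eq_bigr => k _; rewrite linearZ.
exists G, iota; split.
(* The kernel is stable under left multiplications, so by [oct_tr_projection] it contains 4 tr(x)
   times the unit, whose image is a multiple of d. Thus its elements have trace 0; applied to
   conj(y) x, this says that x is orthogonal to every y. *)
- apply/eqP; rewrite -subv0; apply/subvP => x; rewrite memv_ker memv0 => /eqP Gx.
  have G_mul0 y x' : G x' = 0 -> G (oct_mul y x') = 0.
    move=> Gx'; rewrite (oct_basis_expand y) oct_mul_suml linear_sum big1 //= => k _.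
    rewrite oct_mulZl linearZ /=; case: k => -[|k] k8 /=.
      by rewrite -/oct1 oct_mul1l Gx' scaler0.
    by rewrite (G_mul k.+1) // Gx' mulmx0 scaler0.
  have tr0 x' : G x' = 0 -> oct_tr x' = 0.
    move=> Gx'; have /eqP := congr1 G (oct_tr_projection x').
    rewrite linearZ linearB linear_sum /= Gx' big1 => [|t _]; last by rewrite !G_mul0.
    rewrite subr0 -[oct1]/(oct_basis 0) G_basis // scaler_eq0 (negPf d0) orbF.
    by rewrite mulrn_eq0 => /eqP.
  apply: contraTT isT => /oct_nondegenerate[y].
  rewrite -[y]oct_conjK -[oct_conj (oct_conj y)]oct_mul1r -oct_adjl oct_polar_tr.
  by rewrite tr0 ?eqxx // G_mul0.
- move=> v; rewrite iotaE /h -oct_polar_tr.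
  rewrite (big_morph (oct_polar^~ oct1) (fun x y => oct_polarDl x y _) (oct_polar0l _)).
  apply: big1 => k _; rewrite oct_polarZl -[oct1]/(oct_basis 0) oct_basis_polar //.
    by rewrite mul0rn mulr0.
  by rewrite ltnS.
- move=> v x; rewrite iotaE /h oct_mul_suml linear_sum gam_expand mulmx_suml /=.
  apply: eq_bigr => k _; rewrite oct_mulZl linearZ /= G_mul ?scalemxAl //.
Qed.

End CliffordFrame.

(** * Zeros of a section of the spinor bundle *)

Section NullPairImages.
Context {K : numFieldType}.
Local Notation O := (@octonion K).
Implicit Types (x y z : O).

(** Conversely, z -> x (y z) kills x O + y O by anticommutation. At z = 1 this shows that null pairs
    give zeros of the section; transversality uses it at another z. *)
Lemma null_pair_image x y z : null_pair x y -> oct_mul x (oct_mul y z) = 0 ->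
  exists a b, z = oct_mul x a + oct_mul y b.
Proof.
move=> /null_pair_transitive[g [gG <- <-]]; rewrite -(inG2_VK gG z).
rewrite -!(inG2_mulg _ _ gG) => /(congr1 g^-1%VF); rewrite (inG2_K gG) linear0.
case: (octP (g^-1%VF z)) => p q r s p' q' r' s'; rewrite /oct_u0 /oct_v0 !ocM oc0.
move=> /oc_inj[[_ r'0 _ _] [_ r0 _ _]].
have {}r'0 : r' = 0 by rewrite -r'0; ring.
have {}r0 : r = 0 by apply: oppr_inj; rewrite oppr0 -r0; ring.
exists (g (oc 0 0 p q q' 0 s' 0)), (g (oc 0 0 (- p') 0 0 0 s 0)).
rewrite -!(inG2_mulg _ _ gG) -linearD; congr (g _).
by rewrite !ocM ocD r'0 r0; congr oc; ring.
Qed.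

(** By [null_pair_image] the goal is x (y (y' b)) = x (y z). Moving y' to the front and using y b =
    1 - x a, the left side becomes y' x, so y' only has to solve y' x = x (y z). *)
Lemma null_pair_transversal x y z a b :
  null_pair x y -> oct1 = oct_mul x a + oct_mul y b -> exists y',
  [/\ oct_tr y' = 0, oct_polar x y' = 0, oct_polar y y' = 0
    & exists a' b', z - oct_mul y' b = oct_mul x a' + oct_mul y b'].
Proof.
move=> xy xayb; have [tx ty _ _] := xy; have [nx _ _ _] := null_pair_norm xy.
have [y' [ty' xy' yy' y'x]] : exists y', [/\ oct_tr y' = 0, oct_polar x y' = 0,
    oct_polar y y' = 0 & oct_mul y' x = oct_mul x (oct_mul y z)].
  have [g [gG <- <-]] := null_pair_transitive xy; rewrite -(inG2_VK gG z).
  case: (octP (g^-1%VF z)) => p q r s p' q' r' s'.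
  (* At the reference pair x (y z) = r' x - r y, which this y' produces from x. *)
  exists (g (oc r' 0 0 (- r') r 0 0 0)).
  rewrite (proj1 (inG2_tr_norm _ gG)) !inG2_polar // -!(inG2_mulg _ _ gG).
  rewrite /oct_u0 /oct_v0 oct_trE !oct_polarE; split; try ring.
  by congr (g _); rewrite !ocM; congr oc; ring.
exists y'; split; [exact: ty' | exact: xy' | exact: yy' | apply: null_pair_image xy _].
have anti w w' (t : O) : oct_tr w = 0 -> oct_tr w' = 0 -> oct_polar w w' = 0 ->
    oct_mul w (oct_mul w' t) = - oct_mul w' (oct_mul w t).
  move=> tw tw' ww'; have := oct_altl w w' t; rewrite !oct_conj_imag // ww' scale0r.
  by rewrite !oct_mulNl !oct_mulNr -opprD => /eqP; rewrite oppr_eq0 addr_eq0 => /eqP.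
rewrite !oct_mulBr (anti y y' b) // oct_mulNr (anti x y') // opprK.
have -> : oct_mul y b = oct1 - oct_mul x a by rewrite xayb addrC addKr.
rewrite oct_mulBr oct_mul1r oct_alt oct_sqr_imag // nx oppr0 scale0r oct_mul0l subr0.
by rewrite y'x subrr.
Qed.

(** Makes z a multiple of y (y z) with both y and y z imaginary, that is, the result of two Clifford
    multiplications applied to 1. A trace-free matrix in the first half suffices. *)
Lemma exists_imag_orthogonal z :
  exists y : O, [/\ oct_tr y = 0, oct_norm y != 0 & oct_tr (oct_mul y z) = 0].
Proof.
case: (octP z) => p q r s p' q' r' s'.
suff [a [b [c [abc ab0]]]] : exists a b c,
    a * a + b * c != 0 /\ a * p + b * r + c * q - a * s = 0.
  exists (oc a b c (- a) 0 0 0 0); rewrite ocM !oct_trE oct_normE; split.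
  - by rewrite subrr.
  - apply: contra_neq abc => E; apply: oppr_inj; rewrite oppr0 -[RHS]E; ring.
  - by rewrite -[RHS]ab0; ring.
have [q0|q0] := eqVneq q 0; have [r0|r0] := eqVneq r 0.
- exists 0, 1, 1; rewrite q0 r0; split; last by ring.
  by rewrite mul0r add0r mulr1 oner_eq0.
- exists r, (s - p), 0; rewrite q0; split; last by ring.
  by rewrite mulr0 addr0 mulf_neq0.
- exists q, 0, (s - p); rewrite r0; split; last by ring.
  by rewrite mul0r addr0 mulf_neq0.
- exists 0, q, (- r); split; last by ring.
  by rewrite mul0r add0r mulrN oppr_eq0 mulf_neq0.
Qed.

End NullPairImages.

Section CliffordImage.
Context {K : fieldType}.
Variable gam : {linear 'cV[K]_7 -> 'M[K]_8}.

Lemma memv_clifford_image (U : {vspace 'cV[K]_7}) u psi :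
  u \in U -> gam u *m psi \in clifford_image gam U.
Proof.
move=> uU; rewrite (coord_vbasis uU) (coord_vbasis (memvf psi)).
rewrite (linear_sum gam) mulmx_suml memv_suml // => i _.
rewrite mulmx_sumr memv_suml // => j _.
rewrite !linearZ /= -!scalemxAl !memvZ // memv_span //.
by apply/allpairsP; exists ((vbasis U)`_i, (vbasis {:'cV[K]_8})`_j);
  rewrite !memt_nth.
Qed.

Lemma clifford_image_span2 u v x : x \in clifford_image gam <<[:: u; v]>> ->
  exists a b, x = gam u *m a + gam v *m b.
Proof.
have [gu guE] := @exists_lfun _ _ _ (fun a : 'cV[K]_8 => gam u *m a)
  (linearP (mulmx (gam u))).
have [gv gvE] := @exists_lfun _ _ _ (fun a : 'cV[K]_8 => gam v *m a)
  (linearP (mulmx (gam v))).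
suff : (clifford_image gam <<[:: u; v]>> <= limg gu + limg gv)%VS.
  move=> /subvP sub /sub /memv_addP[_ /memv_imgP[a _ ->] [_ /memv_imgP[b _ ->] ->]].
  by exists a, b; rewrite guE gvE.
apply/span_subvP => _ /allpairsP[[w psi] [/= /vbasis_mem + _ ->]].
rewrite span_cons span_seq1 => /memv_addP[_ /vlineP[s ->] [_ /vlineP[t ->] ->]].
rewrite linearD mulmxDl !linearZ /= -!scalemxAl memv_add // memvZ //.
- by rewrite -guE memv_img // memvf.
- by rewrite -gvE memv_img // memvf.
Qed.

End CliffordImage.

(** * Changing frames; zeros and their transversality *)

Section Frames.
Context {K : numClosedFieldType}.
Variables (B : 'M[K]_7) (gam : {linear 'cV[K]_7 -> 'M[K]_8}).
Hypothesis B_nondegenerate : nondegenerate_form B.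
Hypothesis gam_clifford : clifford_action B gam.
Local Notation O := (@octonion K).
Local Notation V := ('cV[K]_7).
Local Notation Delta := ('cV[K]_8).

Section OneFrame.
Variables (G : 'Hom(O, Delta)) (iota : 'Hom(V, O)).
Hypothesis frame : clifford_frame gam G iota.

Lemma frame_K : cancel G G^-1%VF.
Proof. by case: frame => /eqP/lker0_lfunK. Qed.

Lemma frame_VK : cancel G^-1%VF G.
Proof.
have [/eqP G0 _ _] := frame; move=> psi; apply: limg_lfunVK.
suff -> : limg G = fullv by apply: memvf.
apply/eqP; rewrite eqEdim subvf limg_dim_eq ?(eqP G0) ?capv0 //.
by rewrite !dimvf.
Qed.

Lemma frame_act v x : G (oct_mul (iota v) x) = gam v *m G x.
Proof. by case: frame. Qed.

Lemma frame_imag v : oct_tr (iota v) = 0.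
Proof. by case: frame. Qed.

Lemma frame_norm v : oct_norm (iota v) = - polar B v v.
Proof.
have : G (oct_mul (iota v) (iota v)) = gam v *m (gam v *m G oct1).
  by rewrite -!frame_act oct_mul1r.
rewrite mulmxA gam_clifford mul_scalar_mx -linearZ /= => /(can_inj frame_K)/eqP.
rewrite oct_sqr_imag ?frame_imag // -subr_eq0 -scalerBl scaler_eq0.
by rewrite (negPf oct1_neq0) orbF subr_eq0 => /eqP <-; rewrite opprK.
Qed.

Lemma frame_polar u v : oct_polar (iota u) (iota v) = - polar B u v *+ 2.
Proof.
rewrite /oct_polar -linearD !frame_norm polarDl !polarDr.
by rewrite (polarC B_nondegenerate v u); ring.
Qed.

Lemma frame_polar0 u v : oct_polar (iota u) (iota v) = 0 -> polar B u v = 0.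
Proof. by rewrite frame_polar => /eqP; rewrite mulrn_eq0 oppr_eq0 => /eqP. Qed.

Lemma frame_iota_inj : lker iota = 0%VS.
Proof.
apply/eqP; rewrite -subv0; apply/subvP => v; rewrite memv_ker memv0 => /eqP v0.
apply: contraTT isT => /(polar_nondegenerate B_nondegenerate)[w].
by rewrite (@frame_polar0 v w) ?eqxx // v0 oct_polar0l.
Qed.

(** Dimension count: the 7-dimensional image of [iota] is trace-free, so it meets the scalars in 0
    and spans O with them. *)
Lemma frame_iota_surj x : oct_tr x = 0 -> exists v, iota v = x.
Proof.
move=> x0; have : x \in (limg iota + <[oct1]>)%VS.
  suff -> : (limg iota + <[oct1]>)%VS = fullv by apply: memvf.
  apply/eqP; rewrite eqEdim subvf dimv_disjoint_sum.
    rewrite limg_dim_eq ?frame_iota_inj ?capv0 // !dimvf dim_vline oct1_neq0.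
    by rewrite /dim /=.
  apply/eqP; rewrite -subv0; apply/subvP => y; rewrite memv_cap memv0.
  case/andP => /memv_imgP[v _ ->] /vlineP[k yk]; move: (frame_imag v).
  rewrite yk oct_trZ oct_trE -(natrD _ 1 1) => /eqP.
  by rewrite mulf_eq0 pnatr_eq0 orbF => /eqP ->; rewrite scale0r.
case/memv_addP => _ /memv_imgP[v _ ->] [_ /vlineP[k ->] xE]; exists v.
move: x0; rewrite xE oct_trD frame_imag add0r oct_trZ oct_trE -(natrD _ 1 1) => /eqP.
by rewrite mulf_eq0 pnatr_eq0 orbF => /eqP ->; rewrite scale0r addr0.
Qed.

(** The Clifford relation reads [gam v *m gam a = gam a *m gam (r v)], where [r] is minus the
    reflection in [a]. So multiplying G by [gam a] twists [iota] by [r]. *)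
Lemma frame_reflect a : polar B a a != 0 ->
  exists (G' : 'Hom(O, Delta)) (iota' : 'Hom(V, O)),
    clifford_frame gam G' iota' /\ forall x, G' x = gam a *m G x.
Proof.
move=> aa.
have [G' G'E] : exists G' : 'Hom(O, Delta), G' =1 (fun x => gam a *m G x).
  by apply: exists_lfun => k x y; rewrite !linearP.
pose r v := (polar B a v *+ 2 / polar B a a) *: a - v.
have [iota' iotaE] : exists i' : 'Hom(V, O), i' =1 (fun v => iota (r v)).
  apply: exists_lfun => k v w; rewrite -linearP; congr (iota _).
  rewrite /r polarDr polarZr scalerBr opprD addrACA scalerA -scalerDl.
  by congr (_ *: _ + _); ring.
exists G', iota'; split=> //; split.
- apply/eqP; rewrite -subv0; apply/subvP => x; rewrite memv_ker memv0 G'E => /eqP.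
  move/(congr1 (mulmx (gam a))); rewrite mulmxA gam_clifford mul_scalar_mx mulmx0.
  move/eqP; rewrite scaler_eq0 (negPf aa) /= -memv_ker.
  by case: frame => -> _ _; rewrite memv0.
- by move=> v; rewrite iotaE frame_imag.
- move=> v x; rewrite iotaE !G'E frame_act !mulmxA; congr (_ *m _).
  rewrite linearB linearZ /= mulmxBr -scalemxAr gam_clifford.
  rewrite scale_scalar_mx divfK // -(clifford_anticomm B_nondegenerate gam_clifford).
  by rewrite addrC addKr.
Qed.

End OneFrame.

(** With z the octonion of d, reflecting in a vector over y turns z into a multiple of y z. This is
    again imaginary of nonzero norm, and a second reflection moves it to 1. *)
Lemma frame_normalize G iota d : clifford_frame gam G iota ->
  oct_norm (G^-1%VF d) != 0 ->
  exists G' iota', clifford_frame gam G' iota' /\ G' oct1 = d.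
Proof.
move=> fr nd; have [y [ty ny yd]] := exists_imag_orthogonal (G^-1%VF d).
have [a aE] := frame_iota_surj fr ty.
have aa : polar B a a != 0 by rewrite -oppr_eq0 -(frame_norm fr) aE.
have [G1 [iota1 [fr1 G1E]]] := frame_reflect fr aa.
pose x := (polar B a a)^-1 *: oct_mul y (G^-1%VF d).
have G1x : G1 x = d.
  rewrite G1E linearZ /= -aE (frame_act fr) (frame_VK fr) -scalemxAr mulmxA.
  by rewrite gam_clifford mul_scalar_mx scalerA mulVf // scale1r.
have [b bE] : exists b, iota1 b = x.
  by apply: (frame_iota_surj fr1); rewrite oct_trZ yd mulr0.
have bb : polar B b b != 0.
  rewrite -oppr_eq0 -(frame_norm fr1) bE oct_normZ oct_norm_mul.
  by rewrite !mulf_neq0 ?invr_neq0.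
have [G2 [iota2 [fr2 G2E]]] := frame_reflect fr1 bb.
by exists G2, iota2; split=> //; rewrite G2E -(frame_act fr1) bE oct_mul1r.
Qed.

Section NormalizedFrame.
Variables (G : 'Hom(O, Delta)) (iota : 'Hom(V, O)) (d : Delta).
Hypothesis frame : clifford_frame gam G iota.
Hypothesis G1 : G oct1 = d.

Lemma null_pair_zero u v : null_pair (iota u) (iota v) ->
  OG27 B <<[:: u; v]>>%VS /\ exists a b, d = gam u *m a + gam v *m b.
Proof.
move=> uv; have [nu nv Puv _] := null_pair_norm uv; have [_ _ uv0 uvf] := uv.
have uv_free : free [:: u; v].
  apply/free2P => s t /(congr1 iota); rewrite linearD !linearZ linear0 /=.
  by move: s t; apply/free2P.
have Bu : polar B u u = 0 by apply/eqP; rewrite -oppr_eq0 -(frame_norm frame) nu.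
have Bv : polar B v v = 0 by apply/eqP; rewrite -oppr_eq0 -(frame_norm frame) nv.
have Buv := frame_polar0 frame Puv.
split; first split.
- by move/eqP: uv_free.
- move=> w; rewrite span_cons span_seq1.
  case/memv_addP=> _ /vlineP[s ->] [_ /vlineP[t ->] ->].
  rewrite polarDl !polarDr !polarZl !polarZr (polarC B_nondegenerate v u).
  by rewrite Bu Bv Buv !mulr0 !addr0.
have [|a [b ab]] := @null_pair_image _ _ _ oct1 uv; first by rewrite oct_mul1r.
by exists (G a), (G b); rewrite -!(frame_act frame) -linearD /= -ab.
Qed.

Lemma zero_null_pair u v a b : OG27 B <<[:: u; v]>>%VS ->
  d = gam u *m a + gam v *m b -> null_pair (iota u) (iota v).
Proof.
case=> dim_uv iso dE.
have uU : u \in <<[:: u; v]>>%VS by rewrite memv_span ?inE ?eqxx.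
have vU : v \in <<[:: u; v]>>%VS by rewrite memv_span ?inE ?eqxx ?orbT.
have Buv : polar B u v = 0.
  have := iso _ (memvD uU vU); rewrite polarDl !polarDr !iso //.
  rewrite (polarC B_nondegenerate v u) add0r addr0 -mulr2n => /eqP.
  by rewrite mulrn_eq0 => /eqP.
have anti : gam v *m gam u = - (gam u *m gam v).
  apply/eqP; rewrite -addr_eq0 addrC (clifford_anticomm B_nondegenerate) //.
  by rewrite Buv mul0rn raddf0.
have uv_free : free [:: u; v] by rewrite /free dim_uv.
split; rewrite ?(frame_imag frame) //.
  (* As d is the image of 1, G takes the product to [gam u *m (gam v *m d)]. The operators
     anticommute and square to 0, so both terms of d are killed. *)
  apply: (can_inj (frame_K frame)); rewrite linear0 -[iota v]oct_mul1r.
  rewrite !(frame_act frame) G1 dE !mulmxDr !mulmxA -(mulmxA (gam u)) anti.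
  rewrite mulmxN !mulmxA gam_clifford iso // -(mulmxA (gam u)) gam_clifford iso //.
  by rewrite raddf0 !(mul0mx, mulmx0, oppr0) addr0.
apply/free2P => s t; rewrite -!linearZ -linearD /= => /eqP.
by rewrite -memv_ker (frame_iota_inj frame) memv0 => /eqP; apply/free2P.
Qed.

Lemma frame_transversal : transversal_zeros B gam d.
Proof.
move=> u v a b uv_iso dE psi; have uv := zero_null_pair uv_iso dE.
have [|y [ty xy yy [a' [b' ab']]]] :=
  @null_pair_transversal _ _ _ (G^-1%VF psi) (G^-1%VF a) (G^-1%VF b) uv.
  apply: (can_inj (frame_K frame)).
  by rewrite linearD /= !(frame_act frame) !(frame_VK frame) G1.
(* Deformations that fix u and move only v already reach the whole fiber. *)
have [v' v'E] := frame_iota_surj frame ty; exists 0, v'.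
rewrite -v'E in xy yy ab'.
have B0 w : polar B w 0 = 0 by rewrite -(scale0r 0) polarZr mul0r.
split; [exact: B0 | exact: (frame_polar0 frame) | |].
  by rewrite B0 addr0 (frame_polar0 frame).
rewrite linear0 mul0mx add0r -[psi](frame_VK frame) -[b](frame_VK frame).
rewrite -(frame_act frame) -linearB /= ab' linearD /= !(frame_act frame) memvD //.
  by rewrite memv_clifford_image // memv_span ?inE ?eqxx.
by rewrite memv_clifford_image // memv_span ?inE ?eqxx ?orbT.
Qed.

End NormalizedFrame.
End Frames.

(** * Plücker lines and the linear map to End(O) *)

Section Pluecker.
Context {K : fieldType}.
Implicit Types (u v : 'cV[K]_7).

Lemma wedge_comb u v (a b c e : K) :
  wedge (a *: u + b *: v) (c *: u + e *: v) = (a * e - b * c) *: wedge u v.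
Proof.
apply/matrixP => i j; rewrite !mxE !big_ord1 !mxE; ring.
Qed.

Lemma pluecker_span u v : free [:: u; v] ->
  pluecker <<[:: u; v]>> = <[wedge u v]>%VS.
Proof.
move=> uvf; pose U := <<[:: u; v]>>%VS.
have U2 : \dim U = 2%N by apply/eqP.
have mem (i : 'I_(\dim U)) : exists a b, (vbasis U)`_i = a *: u + b *: v.
  have /vbasis_mem : (vbasis U)`_i \in vbasis U by apply: memt_nth.
  move: (_`_i) => w; rewrite /U span_cons span_seq1.
  by move=> /memv_addP[_ /vlineP[a ->] [_ /vlineP[b ->] ->]]; exists a, b.
have i0 : (0 < \dim U)%N by rewrite U2.
have i1 : (1 < \dim U)%N by rewrite U2.
have [a [b E0]] := mem (Ordinal i0); have [c [e E1]] := mem (Ordinal i1).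
rewrite /pluecker -/U E0 E1 wedge_comb vlineZ //.
apply/eqP => det0; have := basis_free (vbasisP U).
have -> : vbasis U = [:: a *: u + b *: v; c *: u + e *: v] :> seq _.
  rewrite -E0 -E1; case: (vbasis U) => s /= /eqP; rewrite U2.
  by case: s => [|x [|y []]].
move/free2P => w_free; have /free2P uv := uvf.
(* If the determinant vanished, the coefficients (e, -b) and then (c, -a) would be relations between
   the two basis vectors, making all four entries zero. *)
have [|e0 /eqP] := w_free e (- b).
  rewrite !scalerDr !scalerA addrACA -!scalerDl !mulNr (mulrC e a) det0 scale0r add0r.
  by rewrite mulrC subrr scale0r.
rewrite oppr_eq0 => /eqP b0.
have [|c0 /eqP] := w_free c (- a).
  rewrite !scalerDr !scalerA addrACA -!scalerDl !mulNr (mulrC c a) subrr scale0r add0r.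
  by rewrite e0 b0 !mulr0 subrr scale0r.
rewrite oppr_eq0 => /eqP a0.
have [|/eqP] := w_free 1 0; last by rewrite oner_eq0.
by rewrite a0 b0 !scale0r !addr0 scaler0.
Qed.

End Pluecker.

Section ZeroLocus.
Context {K : numClosedFieldType}.
Variables (B : 'M[K]_7) (gam : {linear 'cV[K]_7 -> 'M[K]_8}).
Hypothesis B_nondegenerate : nondegenerate_form B.
Hypothesis gam_clifford : clifford_action B gam.
Local Notation O := (@octonion K).
Local Notation V := ('cV[K]_7).
Local Notation Delta := ('cV[K]_8).
Variables (G : 'Hom(O, Delta)) (iota : 'Hom(V, O)) (d : Delta).
Hypothesis frame : clifford_frame gam G iota.
Hypothesis G1 : G oct1 = d.

Lemma zero_locusP L : zero_locus B gam d L <->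
  exists u v, null_pair (iota u) (iota v) /\ L = <[wedge u v]>%VS.
Proof.
split=> [[U [[U2 Uiso] Ud ->]]|[u [v [uv ->]]]].
  have [u [v Uuv]] : exists u v, vbasis U = [:: u; v] :> seq _.
    by case: (vbasis U) => s /= /eqP; rewrite U2; case: s => [|u [|v []]] //; exists u, v.
  have UE : U = <<[:: u; v]>>%VS by rewrite -Uuv (span_basis (vbasisP U)).
  exists u, v; split; last by rewrite /pluecker Uuv.
  have [a [b dE]] : exists a b, d = gam u *m a + gam v *m b.
    by apply: clifford_image_span2; rewrite -UE.
  apply: (zero_null_pair B_nondegenerate gam_clifford frame G1 _ dE).
  by rewrite -UE.
have [uv_iso [a [b dE]]] :=
  null_pair_zero B_nondegenerate gam_clifford frame G1 uv.
exists <<[:: u; v]>>%VS; split=> //; last first.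
  by rewrite pluecker_span // /free; case: uv_iso => ->.
rewrite /section_vanishes dE memvD //.
  by rewrite memv_clifford_image // memv_span ?inE ?eqxx.
by rewrite memv_clifford_image // memv_span ?inE ?eqxx ?orbT.
Qed.

Definition polar_coords (y : O) : V :=
  \col_j oct_polar (iota (delta_mx j 0)) y.

Lemma polar_coordsE (v : V) y : (v^T *m polar_coords y) 0 0 = oct_polar (iota v) y.
Proof.
rewrite mxE (_ : iota v = \sum_j v j 0 *: iota (delta_mx j 0)).
  rewrite (big_morph (oct_polar^~ y) (fun x z => oct_polarDl x z y) (oct_polar0l y)).
  by apply: eq_bigr => j _; rewrite oct_polarZl !mxE.
rewrite {1}(matrix_sum_delta v) linear_sum; apply: eq_bigr => j _.
by rewrite big_ord1 linearZ.
Qed.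

(** Extends [null_derivation] from the matrices [wedge u v] linearly to all of 'M_7, the ambient
    space of the zero locus. *)
Definition pluecker_der (M : 'M[K]_7) (y : O) : O := iota (M *m polar_coords y).

Lemma pluecker_der_linear M : linear (pluecker_der M).
Proof.
move=> k x y; rewrite /pluecker_der -linearP scalemxAr -mulmxDr; congr (iota (_ *m _)).
by apply/matrixP => i j; rewrite !mxE oct_polarDr oct_polarZr.
Qed.

HB.instance Definition _ M :=
  GRing.isLinear.Build K O O *:%R (pluecker_der M) (pluecker_der_linear M).

Lemma pluecker_der_linear2 : linear (fun M => linfun (pluecker_der M)).
Proof.
move=> k M N; apply/lfunP => y; rewrite !lfunE /= !lfunE /= !lfunE /=.
by rewrite /pluecker_der -linearP mulmxDl scalemxAl.
Qed.

Lemma exists_pluecker_lfun : exists T : 'Hom('M[K]_7, 'End(O)),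
  lker T = 0%VS /\
  forall u v, T (wedge u v) = null_derivation (iota u) (iota v).
Proof.
have [T TE] : exists T : 'Hom('M[K]_7, 'End(O)),
    forall M y, T M y = iota (M *m polar_coords y).
  have [T TE] := exists_lfun pluecker_der_linear2.
  by exists T => M y; rewrite TE lfunE.
exists T; split.
  apply/eqP; rewrite -subv0; apply/subvP => M; rewrite memv_ker memv0 => /eqP TM.
  (* If row i were nonzero, some y would pair nontrivially with its [iota]; that pairing is entry i
     of [M *m polar_coords y], which is 0. *)
  apply/eqP/row_matrixP => i; rewrite row0; apply/eqP.
  have : iota (row i M)^T == 0.
    apply: contraT => /oct_nondegenerate[y]; rewrite -polar_coordsE trmxK -row_mul.
    have /eqP : iota (M *m polar_coords y) = 0 by rewrite -TE TM zero_lfunE.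
    rewrite -memv_ker (frame_iota_inj B_nondegenerate gam_clifford frame) memv0.
    by move/eqP ->; rewrite row0 mxE eqxx.
  rewrite -memv_ker (frame_iota_inj B_nondegenerate gam_clifford frame) memv0.
  by rewrite trmx_eq0.
move=> u v; apply/lfunP => y; rewrite TE null_derivationE -!linearZ -linearB.
congr (iota _); rewrite /wedge mulmxBl -!mulmxA.
rewrite [v^T *m _]mx11_scalar [u^T *m _]mx11_scalar !mul_mx_scalar.
by rewrite !polar_coordsE.
Qed.

Lemma zero_locus_isomorphic :
  isomorphic_varieties (zero_locus B gam d) (@long_root_line K).
Proof.
have [T [T0 TE]] := exists_pluecker_lfun.
apply: (isomorphic_lfun T0) => [L /zero_locusP[u [v [uv ->]]]|M].
  have [D [D0 _ _ DL]] := null_derivation_line uv.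
  rewrite dim_vline; case: eqP => // uv0.
  have := dim_vline D; by rewrite -DL -TE uv0 linear0 dim_vline eqxx D0.
split=> [/long_root_lineP[x [y [xy ->]]]|[L /zero_locusP[u [v [uv ->]]] ->]].
  have [tx ty _ _] := xy.
  have [u uE] := frame_iota_surj B_nondegenerate gam_clifford frame tx.
  have [v vE] := frame_iota_surj B_nondegenerate gam_clifford frame ty.
  exists <[wedge u v]>%VS; last by rewrite limg_line TE uE vE.
  by apply/zero_locusP; exists u, v; rewrite uE vE.
rewrite limg_line TE; exact: null_derivation_line.
Qed.

End ZeroLocus.

(** For f the inverse of a frame, F = 0 is the Spin-invariant quadric of spinors, the hypersurface
    that a general section avoids. *)
Lemma exists_norm_poly (K : fieldType) n (f : 'Hom('cV[K]_n, @octonion K)) :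
  exists F : {mpoly K[n]}, forall d : 'cV[K]_n, F.@[fun i => d i 0] = oct_norm (f d).
Proof.
pose lin (c : @octonion K -> K) : {mpoly K[n]} := \sum_i c (f (delta_mx i 0)) *: 'X_i.
have linE (c : {linear @octonion K -> K^o}) (d : 'cV[K]_n) :
    (lin c).@[fun i => d i 0] = c (f d).
  rewrite {2}(matrix_sum_delta d) raddf_sum !linear_sum; apply: eq_bigr => i _.
  by rewrite big_ord1 /= mevalZ mevalXU !linearZ /= mulrC.
have fst_lin i j : linear (fun x : @octonion K => x.1 i j : K^o).
  by move=> k x y; rewrite !mxE.
have snd_lin i j : linear (fun x : @octonion K => x.2 i j : K^o).
  by move=> k x y; rewrite !mxE.
pose c1 i j : {linear @octonion K -> K^o} :=
  HB.pack (fun x : @octonion K => x.1 i j : K^o)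
    (GRing.isLinear.Build _ _ _ _ _ (fst_lin i j)).
pose c2 i j : {linear @octonion K -> K^o} :=
  HB.pack (fun x : @octonion K => x.2 i j : K^o)
    (GRing.isLinear.Build _ _ _ _ _ (snd_lin i j)).
exists (lin (c1 0 0) * lin (c1 1 1) - lin (c1 0 1) * lin (c1 1 0) +
        (lin (c2 0 0) * lin (c2 1 1) - lin (c2 0 1) * lin (c2 1 0))).
by move=> d; rewrite mevalD !mevalB !mevalM !linE.
Qed.

Theorem proposition2 (R : realType)
    (B : 'M[R[i]]_7) (gam : {linear 'cV[R[i]]_7 -> 'M[R[i]]_8})
    (B_nondegenerate : nondegenerate_form B)
    (gam_clifford : clifford_action B gam) :
  exists2 X : {vspace 'End(@octonion R[i])} -> Prop, is_adjoint_variety X &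
    for_general (fun d : 'cV[R[i]]_8 =>
      transversal_zeros B gam d /\
      isomorphic_varieties (zero_locus B gam d) X).
Proof.
exists (@long_root_line R[i]); first exact: long_root_line_adjoint.
have [G [iota fr]] := exists_clifford_frame B_nondegenerate gam_clifford.
have [F FE] := exists_norm_poly G^-1%VF; exists F.
  apply/eqP => F0; have := FE (G oct1); rewrite F0 meval0 (frame_K fr) oct_normE.
  by rewrite mulr0 mulr1 !subr0 addr0 => /eqP; rewrite eq_sym oner_eq0.
(* The new frame depends on d, while the adjoint variety was fixed beforehand. *)
move=> d; rewrite FE => nd.
have [G' [iota' [fr' G'1]]] := frame_normalize B_nondegenerate gam_clifford fr nd.
split.
  exact: (frame_transversal B_nondegenerate gam_clifford fr' G'1).
exact: (zero_locus_isomorphic B_nondegenerate gam_clifford fr' G'1).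
Qed.
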